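(* Let $\theta$ be a nondegenerate skew symmetric real $d \times d$ matrix. Let $n \geq 1$ be an integer with $n \neq 1$, let $\omega = \exp(2\pi i/n)$, let $1 \leq k \leq d$, and let $\alpha \colon A_{\theta} \to A_{\theta}$ be the unique automorphism satisfying $\alpha(u_k) = \omega u_k$ and $\alpha(u_r) = u_r$ for $r \neq k$. Then the action of $\mathbb{Z}/n\mathbb{Z}$ on $A_\theta$ generated by $\alpha$ does not have the Rokhlin property.
   Context: For a skew symmetric real $d \times d$ matrix $\theta$, the noncommutative torus $A_{\theta}$ is the universal C*-algebra generated by unitaries $u_1, \dots, u_d$ subject to the relations $u_k u_j = \exp(2\pi i \theta_{j,k}) u_j u_k$ for $1 \leq j,k \leq d$. The matrix $\theta$ is nondegenerate if whenever $x \in \mathbb{Z}^d$ satisfies $\exp(2\pi i \langle x, \theta y\rangle) = 1$ for all $y \in \mathbb{Z}^d$, then $x = 0$. Rokhlin property (in the sense of Izumi, for finite cyclic group actions): let $A$ be a separable unital C*-algebra and let $\alpha \in \mathrm{Aut}(A)$ satisfy $\alpha^n = \mathrm{id}_A$. The action of $\mathbb{Z}/n\mathbb{Z}$ generated by $\alpha$ has the Rokhlin property if for every finite set $F \subset A$ and every $\varepsilon > 0$ there are mutually orthogonal projections $e_0, e_1, \dots, e_{n-1} \in A$ with $\sum_{j=0}^{n-1} e_j = 1$ such that $\|\alpha(e_j) - e_{j+1}\| < \varepsilon$ for $0 \leq j \leq n-1$ (with $e_n = e_0$) and $\|e_j a - a e_j\| < \varepsilon$ for $0 \leq j \leq n-1$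 and all $a \in F$. *)

(* Defs.v *)
From HB Require Import structures.
From mathcomp Require Import all_boot all_order all_algebra.
From mathcomp Require Import complex.
From mathcomp Require Import all_classical all_reals all_analysis.

Set Implicit Arguments.
Unset Strict Implicit.
Unset Printing Implicit Defensive.

Import Order.TTheory GRing.Theory Num.Theory ComplexField.

Local Open Scope ring_scope.
Local Open Scope complex_scope.

(* Completeness is spelled out with Cauchy sequences because no MathComp
   structure joins the ring hierarchy with [completeNormedModType]: the latter
   meets the former only at [numDomainType]. Nonnegativity of the norm follows
   from [cnormD] and [cnormZ]. *)
HB.mixin Record isUnitalCStar (R : realType) A & GRing.Algebra R[i] A := {
  cnorm : A -> R;
  star : A -> A;
  cnorm_eq0 : forall x : A, cnorm x = 0 -> x = 0;
  cnormD : forall x y : A, cnorm (x + y) <= cnorm x + cnorm y;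
  cnormZ : forall (c : R[i]) (x : A), cnorm (c *: x) = Normc.normc c * cnorm x;
  cnormM : forall x y : A, cnorm (x * y) <= cnorm x * cnorm y;
  cnorm_complete : forall s : nat -> A,
    (forall eps : R, 0 < eps -> exists N : nat, forall m n : nat,
       (N <= m)%N -> (N <= n)%N -> cnorm (s m - s n) < eps) ->
    exists l : A, forall eps : R, 0 < eps -> exists N : nat, forall n : nat,
       (N <= n)%N -> cnorm (s n - l) < eps;
  starK : involutive star;
  starD : forall x y : A, star (x + y) = star x + star y;
  starZ : forall (c : R[i]) (x : A), star (c *: x) = c^*%C *: star x;
  starM : forall x y : A, star (x * y) = star y * star x;
  cnorm_star : forall x : A, cnorm (star x * x) = cnorm x ^+ 2
}.

(* An [algType] is a nonzero ring, so the zero algebra is excluded. *)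
#[short(type="cstarAlgType")]
HB.structure Definition UnitalCStar (R : realType) :=
  { A of isUnitalCStar R A & GRing.Algebra R[i] A }.

Section CStarNotions.
Variable R : realType.

Definition unitary (A : cstarAlgType R) (u : A) : Prop :=
  star u * u = 1 /\ u * star u = 1.

Definition projection (A : cstarAlgType R) (e : A) : Prop :=
  star e = e /\ e * e = e.

Definition star_preserving (A B : cstarAlgType R) (f : A -> B) : Prop :=
  forall x : A, f (star x) = star (f x).

Definition star_automorphism (A : cstarAlgType R)
    (alpha : {lrmorphism A -> A}) : Prop :=
  star_preserving alpha /\ bijective alpha.

(* exp(2 pi i t) for real t *)
Definition expi2pi (t : R) : R[i] :=
  cos (2 * pi * t) +i* sin (2 * pi * t).

Definition skew_symmetric_mx (d : nat) (theta : 'M[R]_d) : Prop :=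
  theta^T = - theta.

Definition int_form (d : nat) (theta : 'M[R]_d) (x y : 'cV[int]_d) : R :=
  \sum_(i < d) (x i 0)%:~R * (theta *m map_mx intr y) i 0.

Definition nondegenerate_mx (d : nat) (theta : 'M[R]_d) : Prop :=
  forall x : 'cV[int]_d,
    (forall y : 'cV[int]_d, expi2pi (int_form theta x y) = 1) -> x = 0.

Definition torus_relations (d : nat) (theta : 'M[R]_d)
    (A : cstarAlgType R) (u : 'I_d -> A) : Prop :=
  (forall j, unitary (u j)) /\
  (forall j k, u k * u j = expi2pi (theta j k) *: (u j * u k)).

(* The noncommutative torus is given by its universal property, hence up to
   a unique isomorphism matching the generators. Generation of A by the u_j
   follows from uniqueness: the C*-subalgebra they generate is universal too. *)
Definition noncommutative_torus (d : nat) (theta : 'M[R]_d)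
    (A : cstarAlgType R) (u : 'I_d -> A) : Prop :=
  torus_relations theta u /\
  forall (B : cstarAlgType R) (v : 'I_d -> B), torus_relations theta v ->
    exists phi : {lrmorphism A -> B},
      [/\ star_preserving phi, forall j, phi (u j) = v j &
          forall psi : {lrmorphism A -> B}, star_preserving psi ->
            (forall j, psi (u j) = v j) -> psi =1 phi].

(* Meant for a separable A and an automorphism alpha with alpha^n = id;
   [ordS] is the cyclic successor of 'I_n, which encodes e_n = e_0. *)
Definition rokhlin_property (A : cstarAlgType R) (n : nat)
    (alpha : {lrmorphism A -> A}) : Prop :=
  forall (F : seq A) (eps : R), 0 < eps ->
    exists e : 'I_n -> A,
      [/\ forall j, projection (e j),
          forall i j, i != j -> e i * e j = 0,
          \sum_(j < n) e j = 1,
          forall j, cnorm (alpha (e j) - e (ordS j)) < eps &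
          forall j (a : A), a \in F -> cnorm (e j * a - a * e j) < eps].

End CStarNotions.

(* Main.v *)
(** For irrational theta the algebra A_theta has no finite-dimensional
representations, but it has asymptotic ones: approximate the entries of theta
by fractions with prime denominator p and let u_j act on l^2((Z/p)^d) by
twisted translations. Letting p run through primes tending to infinity, the
bounded sequences of matrices modulo the null sequences form a C*-algebra B, and
the universal property gives phi : A_theta -> B. Multiplication operators
x |-> exp(2 pi i b x_k / p) with b / p close to 1 / n give a unitary w of B with
phi o alpha = Ad(w^* ) o phi, by uniqueness in the universal property.

If e_0, ..., e_(n-1) are Rokhlin projections, alpha(e_j) is close, hence similar,
to e_(j+1), so the projections phi(e_j) of B are pairwise orthogonal and similar
and sum to 1. They lift to idempotent matrices which for large p have equal
ranks adding up to the dimension p^d. Hence n divides p^d, which is absurd when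
p > n > 1. *)

Require Import Defs.
From HB Require Import structures.
From mathcomp Require Import all_boot all_order all_algebra.
From mathcomp Require Import complex.
From mathcomp Require Import all_classical all_reals all_analysis.
From mathcomp Require Import ring lra.

Set Implicit Arguments.
Unset Strict Implicit.
Unset Printing Implicit Defensive.

Import Order.TTheory GRing.Theory Num.Theory.
Local Open Scope ring_scope.
Local Open Scope sesquilinear_scope.
Local Open Scope quotient_scope.

Local Notation normc := ComplexField.Normc.normc.

(** * Operator bounds for matrices acting on row vectors *)

Section RowNorm.
Variable R : realType.
Implicit Types (q : nat).

(** With [A], [B], [S] as in the proof, the sum of the squares of [B * a i - S * b i] equals
    [B * (A * B - S ^+ 2)]. Divide by [B]; if [B = 0], all [b i] vanish. *)
Lemma cauchy_schwarz_sum (I : finType) (a b : I -> R) :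
  \sum_i a i * b i <=
  Num.sqrt (\sum_i a i ^+ 2) * Num.sqrt (\sum_i b i ^+ 2).
Proof.
set A := \sum_i a i ^+ 2; set B := \sum_i b i ^+ 2; set S := \sum_i _.
have A0 : 0 <= A by apply: sumr_ge0 => i _; exact: sqr_ge0.
have B0 : 0 <= B by apply: sumr_ge0 => i _; exact: sqr_ge0.
have key : 0 <= B * (A * B - S ^+ 2).
  rewrite (_ : _ * _ = \sum_i (B * a i - S * b i) ^+ 2); last first.
    rewrite (eq_bigr (fun i => B ^+ 2 * a i ^+ 2 - (2 * B * S) * (a i * b i)
      + S ^+ 2 * b i ^+ 2)); last by move=> i _; ring.
    rewrite big_split /= sumrB -!mulr_sumr -/A -/B -/S; ring.
  by apply: sumr_ge0 => i _; exact: sqr_ge0.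
rewrite -sqrtrM //.
have [B_eq0|B_neq0] := eqVneq B 0.
  have b0 i : b i = 0.
    apply/eqP; rewrite -sqrf_eq0; apply/eqP.
    by apply: (psumr_eq0P (P := xpredT) _ B_eq0) => // j _; exact: sqr_ge0.
  by rewrite /S big1 ?sqrtr_ge0 // => i _; rewrite b0 mulr0.
have Bgt0 : 0 < B by rewrite lt_def B_neq0.
rewrite pmulr_rge0 // subr_ge0 in key.
by rewrite (le_trans (ler_norm _)) // -sqrtr_sqr ler_sqrt // mulr_ge0.
Qed.

Definition l2norm q (v : 'rV[R[i]]_q) : R :=
  Num.sqrt (\sum_j normc (v 0 j) ^+ 2).

Lemma normc_ge0 (z : R[i]) : 0 <= normc z.
Proof. by case: z => a b; exact: sqrtr_ge0. Qed.

Lemma l2norm_ge0 q (v : 'rV[R[i]]_q) : 0 <= l2norm v.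
Proof. exact: sqrtr_ge0. Qed.

Lemma sqr_l2norm q (v : 'rV[R[i]]_q) :
  l2norm v ^+ 2 = \sum_j normc (v 0 j) ^+ 2.
Proof. by rewrite sqr_sqrtr // sumr_ge0 // => j _; exact: sqr_ge0. Qed.

Lemma l2norm_eq0 q (v : 'rV[R[i]]_q) : l2norm v = 0 -> v = 0.
Proof.
move=> v0; apply/rowP => j; rewrite mxE.
have s0 : \sum_j normc (v 0 j) ^+ 2 = 0 by rewrite -sqr_l2norm v0 expr0n.
apply: ComplexField.Normc.eq0_normc; apply/eqP; rewrite -sqrf_eq0; apply/eqP.
by apply: (psumr_eq0P (P := xpredT) _ s0) => // i _; exact: sqr_ge0.
Qed.

Lemma l2norm0 q : l2norm (0 : 'rV[R[i]]_q) = 0.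
Proof.
rewrite /l2norm big1 ?sqrtr0 // => j _.
by rewrite mxE ComplexField.Normc.normc0 expr0n.
Qed.

Lemma l2normZ q c (v : 'rV[R[i]]_q) : l2norm (c *: v) = normc c * l2norm v.
Proof.
rewrite /l2norm (eq_bigr (fun j => normc c ^+ 2 * normc (v 0 j) ^+ 2)).
  by rewrite -mulr_sumr sqrtrM ?sqr_ge0 // sqrtr_sqr ger0_norm ?normc_ge0.
by move=> j _; rewrite mxE ComplexField.Normc.normcM exprMn.
Qed.

Lemma l2normN q (v : 'rV[R[i]]_q) : l2norm (- v) = l2norm v.
Proof.
rewrite /l2norm; congr Num.sqrt; apply: eq_bigr => j _.
by rewrite mxE normcN.
Qed.

Lemma l2normD q (v w : 'rV[R[i]]_q) : l2norm (v + w) <= l2norm v + l2norm w.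
Proof.
rewrite -(ler_pXn2r (n := 2)) ?nnegrE ?addr_ge0 ?l2norm_ge0 //.
rewrite sqrrD !sqr_l2norm.
have := cauchy_schwarz_sum (fun j => normc (v 0 j)) (fun j => normc (w 0 j)).
rewrite -/(l2norm v) -/(l2norm w) => cs.
apply: (@le_trans _ _ (\sum_j (normc (v 0 j) + normc (w 0 j)) ^+ 2)).
  apply: ler_sum => j _; rewrite ler_pXn2r ?nnegrE ?addr_ge0 ?normc_ge0 //.
  by rewrite mxE le_normcD.
rewrite (eq_bigr (fun j => normc (v 0 j) ^+ 2
  + 2 * (normc (v 0 j) * normc (w 0 j)) + normc (w 0 j) ^+ 2)); last first.
  by move=> j _; ring.
rewrite !big_split /= -mulr_sumr; lra.
Qed.

Lemma normc_sum (I : finType) (z : I -> R[i]) :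
  normc (\sum_i z i) <= \sum_i normc (z i).
Proof.
elim/big_rec2: _ => [|i x y _ le_yx]; first by rewrite ComplexField.Normc.normc0.
by apply: le_trans (le_normcD _ _) _; rewrite lerD2l.
Qed.

Lemma normcJ (z : R[i]) : normc (z^*)%C = normc z.
Proof. by case: z => a b /=; rewrite sqrrN. Qed.

Lemma mulcJ (z : R[i]) : z * (z^*)%C = ((normc z) ^+ 2)%:C%C.
Proof. by rewrite -sqr_normc normc_def rmorphXn; case: z. Qed.

Lemma dot_l2norm q (v : 'rV[R[i]]_q) :
  (v *m v^t*) 0 0 = ((l2norm v) ^+ 2)%:C%C.
Proof.
rewrite mxE sqr_l2norm rmorph_sum; apply: eq_bigr => j _.
by rewrite !mxE; exact: mulcJ.
Qed.

Lemma cauchy_schwarz_dot q (v w : 'rV[R[i]]_q) :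
  normc ((v *m w^t*) 0 0) <= l2norm v * l2norm w.
Proof.
rewrite mxE; apply: le_trans (normc_sum _) _.
rewrite (eq_bigr (fun j => normc (v 0 j) * normc (w 0 j))).
  exact: cauchy_schwarz_sum.
by move=> j _; rewrite ComplexField.Normc.normcM !mxE; congr (_ * _); exact: normcJ.
Qed.

End RowNorm.

(** * Calculus of upper bounds for the operator norm *)

Section OperatorBound.
Variables (R : realType) (q : nat).
Implicit Types (x y : 'M[R[i]]_q) (r s : R).

(** A relation instead of a norm: [r] is any upper bound for the Euclidean operator norm, so no
    supremum has to be formed. *)
Definition opbound x r := forall v : 'rV_q, l2norm (v *m x) <= r * l2norm v.

Lemma opboundW x r s : r <= s -> opbound x r -> opbound x s.
Proof.
move=> rs xr v; apply: le_trans (xr v) _.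
by rewrite ler_wpM2r // l2norm_ge0.
Qed.

Lemma opbound0 : opbound 0 0.
Proof. by move=> v; rewrite mulmx0 l2norm0 mul0r. Qed.

Lemma opbound1 : opbound 1%:M 1.
Proof. by move=> v; rewrite mulmx1 mul1r. Qed.

Lemma opboundD x y r s : opbound x r -> opbound y s -> opbound (x + y) (r + s).
Proof.
move=> xr ys v; rewrite mulmxDr mulrDl.
exact: le_trans (l2normD _ _) (lerD (xr v) (ys v)).
Qed.

Lemma opboundN x r : opbound x r -> opbound (- x) r.
Proof. by move=> xr v; rewrite mulmxN l2normN. Qed.

Lemma opboundB x y r s : opbound x r -> opbound y s -> opbound (x - y) (r + s).
Proof. by move=> xr /opboundN; exact: opboundD. Qed.

Lemma opboundZ c x r : opbound x r -> opbound (c *: x) (normc c * r).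
Proof.
move=> xr v; rewrite -scalemxAr l2normZ -mulrA.
by rewrite ler_wpM2l ?normc_ge0.
Qed.

Lemma opboundM x y r s :
  0 <= s -> opbound x r -> opbound y s -> opbound (x *m y) (r * s).
Proof.
move=> s0 xr ys v; rewrite mulmxA; apply: le_trans (ys _) _.
by rewrite (mulrC r) -mulrA ler_wpM2l.
Qed.

Lemma l2norm_mul_adj x (v : 'rV_q) :
  l2norm (v *m x) ^+ 2 <= l2norm (v *m (x *m x^t*)) * l2norm v.
Proof.
have : normc ((v *m x *m (v *m x)^t*) 0 0) <=
    l2norm (v *m (x *m x^t*)) * l2norm v.
  rewrite trmx_mul map_mxM (mulmxA _ (x^t*)) -(mulmxA v).
  exact: cauchy_schwarz_dot.
rewrite dot_l2norm; apply: le_trans.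
by rewrite /= expr0n addr0 sqrtr_sqr ler_norm.
Qed.

Lemma opbound_cstar x r : 0 <= r -> opbound (x *m x^t*) (r ^+ 2) -> opbound x r.
Proof.
move=> r0 xr v; rewrite -(ler_pXn2r (n := 2)) ?nnegrE ?mulr_ge0 ?l2norm_ge0 //.
apply: le_trans (l2norm_mul_adj _ _) _.
by rewrite exprMn expr2 (expr2 (l2norm v)) mulrA ler_wpM2r ?l2norm_ge0 // -expr2.
Qed.

Lemma opbound_adj x r : 0 <= r -> opbound x r -> opbound (x^t*) r.
Proof.
move=> r0 xr v; have := l2norm_mul_adj (x^t*) v.
rewrite trmxCK mulmxA => le1.
have le2 : l2norm (v *m x^t*) ^+ 2 <= r * l2norm (v *m x^t*) * l2norm v.
  by apply: le_trans le1 _; rewrite ler_wpM2r ?l2norm_ge0.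
have [->|nz] := eqVneq (l2norm (v *m x^t*)) 0; first by rewrite mulr_ge0 ?l2norm_ge0.
have gt0 : 0 < l2norm (v *m x^t*) by rewrite lt_def nz l2norm_ge0.
by rewrite -(ler_pM2l gt0) -expr2; apply: le_trans le2 _; rewrite mulrCA mulrA.
Qed.

Lemma opbound_diag (d : 'rV[R[i]]_q) r :
  0 <= r -> (forall j, normc (d 0 j) <= r) -> opbound (diag_mx d) r.
Proof.
move=> r0 dr v; rewrite -(ler_pXn2r (n := 2)) ?nnegrE ?mulr_ge0 ?l2norm_ge0 //.
rewrite exprMn !sqr_l2norm mulr_sumr; apply: ler_sum => j _.
rewrite mul_mx_diag mxE ComplexField.Normc.normcM exprMn mulrC.
by rewrite ler_wpM2r ?sqr_ge0 // ler_pXn2r ?nnegrE ?normc_ge0.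
Qed.

Lemma opbound_unitary x : x *m x^t* = 1%:M -> opbound x 1.
Proof.
by move=> x1; apply: opbound_cstar => //; rewrite x1 expr1n; exact: opbound1.
Qed.

(** This turns norm estimates into rank statements: a kernel is trivial once each of its vectors is
    shorter than itself. *)
Lemma opbound_contract_eq0 r (v : 'rV[R[i]]_q) :
  r < 1 -> l2norm v <= r * l2norm v -> v = 0.
Proof.
move=> r1 le_v; apply: l2norm_eq0; apply/eqP; rewrite eq_le l2norm_ge0 andbT.
have := l2norm_ge0 v; nra.
Qed.

End OperatorBound.

(** * Bounded matrix sequences modulo null sequences *)

Section AsymptoticBounds.
Variables (R : realType) (q : nat -> nat).

Definition matseq := forall N, 'M[R[i]]_((q N).+1).
Implicit Types (x y : matseq) (r s : R).

Definition evbound x r :=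
  exists N0, forall N, (N0 <= N)%N -> opbound (x N) r.

Definition null x := forall r, 0 < r -> evbound x r.

(* The limit superior of the operator norms of the [x N]. *)
Definition asnorm x : R := inf [set r | 0 <= r /\ evbound x r]%classic.

Lemma evboundW x r s : r <= s -> evbound x r -> evbound x s.
Proof. by move=> rs [N0 xr]; exists N0 => N /xr; exact: opboundW. Qed.

Lemma evbound_eventually x y r :
  (exists N0, forall N, (N0 <= N)%N -> x N = y N) -> evbound x r -> evbound y r.
Proof.
move=> [N1 xy] [N0 xr]; exists (maxn N0 N1) => N.
by rewrite geq_max => /andP[/xr ? /xy <-].
Qed.

Lemma evboundD x y r s :
  evbound x r -> evbound y s -> evbound (fun N => x N + y N) (r + s).
Proof.
move=> [N0 xr] [N1 ys]; exists (maxn N0 N1) => N.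
by rewrite geq_max => /andP[/xr ? /ys ?]; exact: opboundD.
Qed.

Lemma evboundB x y r s :
  evbound x r -> evbound y s -> evbound (fun N => x N - y N) (r + s).
Proof.
move=> [N0 xr] [N1 ys]; exists (maxn N0 N1) => N.
by rewrite geq_max => /andP[/xr ? /ys ?]; exact: opboundB.
Qed.

Lemma evboundN x r : evbound x r -> evbound (fun N => - x N) r.
Proof. by move=> [N0 xr]; exists N0 => N /xr; exact: opboundN. Qed.

Lemma evboundZ c x r : evbound x r -> evbound (fun N => c *: x N) (normc c * r).
Proof. by move=> [N0 xr]; exists N0 => N /xr; exact: opboundZ. Qed.

Lemma evboundM x y r s : 0 <= s ->
  evbound x r -> evbound y s -> evbound (fun N => x N *m y N) (r * s).
Proof.
move=> s0 [N0 xr] [N1 ys]; exists (maxn N0 N1) => N.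
by rewrite geq_max => /andP[/xr ? /ys ?]; exact: opboundM.
Qed.

Lemma evbound_adj x r : 0 <= r -> evbound x r -> evbound (fun N => (x N)^t*) r.
Proof. by move=> r0 [N0 xr]; exists N0 => N /xr; exact: opbound_adj. Qed.

Lemma evbound_cstar x r :
  0 <= r -> evbound (fun N => x N *m (x N)^t*) (r ^+ 2) -> evbound x r.
Proof. by move=> r0 [N0 xr]; exists N0 => N /xr; exact: opbound_cstar. Qed.

Lemma has_inf_asnorm x : (exists r, 0 <= r /\ evbound x r) ->
  has_inf [set r | 0 <= r /\ evbound x r]%classic.
Proof. by move=> [r xr]; split; [exists r | exists 0 => s []]. Qed.

Lemma asnorm_le x r : 0 <= r -> evbound x r -> asnorm x <= r.
Proof. by move=> r0 xr; apply: ge_inf => //; exists 0 => s []. Qed.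

(** The inequality must be strict, because the infimum defining [asnorm] need not be attained. *)
Lemma asnorm_lt x r : (exists r, 0 <= r /\ evbound x r) ->
  asnorm x < r -> evbound x r.
Proof.
move=> /has_inf_asnorm infx xr.
have [//|s [s0 xs] sr] := inf_adherent (eps := r - asnorm x) _ infx.
  by rewrite subr_gt0.
by apply: evboundW xs; apply: ltW; move: sr; rewrite -/(asnorm x) addrC subrK.
Qed.

Lemma asnorm_ge0 x : (exists r, 0 <= r /\ evbound x r) -> 0 <= asnorm x.
Proof. by move=> /has_inf_asnorm [ne _]; apply: lb_le_inf => // r []. Qed.

Lemma nullD x y : null x -> null y -> null (fun N => x N + y N).
Proof.
by move=> x0 y0 r r0; rewrite [r]splitr; apply: evboundD; [apply: x0|apply: y0];
  rewrite divr_gt0.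
Qed.

Lemma nullN x : null x -> null (fun N => - x N).
Proof. by move=> x0 r r0; apply: evboundN; exact: x0. Qed.

(** Tolerances are divided by [s + 1] rather than [s], which covers [s = 0] without a case
    distinction. *)
Lemma mulr_divS_le r s : 0 <= s -> 0 < r -> s * (r / (s + 1)) <= r.
Proof.
move=> s0 r0; rewrite mulrA ler_pdivrMr; last lra.
by rewrite mulrC ler_pM2l // lerDl.
Qed.

Lemma nullMr x y s : 0 <= s -> evbound y s -> null x -> null (fun N => x N *m y N).
Proof.
move=> s0 ys x0 r r0; apply: (@evboundW _ (r / (s + 1) * s)).
  by rewrite mulrC mulr_divS_le.
by apply: evboundM => //; apply: x0; rewrite divr_gt0 //; lra.
Qed.

Lemma nullMl x y s : 0 <= s -> evbound x s -> null y -> null (fun N => x N *m y N).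
Proof.
move=> s0 xs y0 r r0; apply: (@evboundW _ (s * (r / (s + 1)))); first exact: mulr_divS_le.
by apply: evboundM => //; [rewrite ltW //|apply: y0]; rewrite divr_gt0 //; lra.
Qed.

Lemma nullZ c x : null x -> null (fun N => c *: x N).
Proof.
move=> x0 r r0; have c0 := normc_ge0 c.
apply: (@evboundW _ (normc c * (r / (normc c + 1)))).
  exact: mulr_divS_le.
by apply: evboundZ; apply: x0; rewrite divr_gt0 //; lra.
Qed.

Lemma null_adj x : null x -> null (fun N => (x N)^t*).
Proof. by move=> x0 r r0; apply: evbound_adj; [exact: ltW|exact: x0]. Qed.

Lemma eq_null x y : (forall N, x N = y N) -> null x -> null y.
Proof. by move=> xy x0 r /x0; apply: evbound_eventually; exists 0. Qed.

End AsymptoticBounds.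

(** * Algebra operations on the quotient *)

Section AsymptoticQuotient.
Variables (R : realType) (q : nat -> nat).

Record bseq := BSeq {
  bval :> forall N, 'M[R[i]]_((q N).+1);
  bvalP : exists r, 0 <= r /\ evbound bval r }.

HB.instance Definition _ := gen_eqMixin bseq.
HB.instance Definition _ := gen_choiceMixin bseq.

Definition bseq_eqv (x y : bseq) : bool := `[< null (fun N => x N - y N) >].

Lemma bseq_eqv_refl : reflexive bseq_eqv.
Proof.
move=> x; apply/asboolP => r r0; exists 0 => N _; rewrite subrr.
by apply: opboundW (@opbound0 _ _); exact: ltW.
Qed.

Lemma bseq_eqv_sym : symmetric bseq_eqv.
Proof.
by move=> x y; apply/asboolP/asboolP => /nullN; apply: eq_null => N; rewrite opprB.
Qed.

Lemma bseq_eqv_trans : transitive bseq_eqv.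
Proof.
move=> y x z /asboolP xy /asboolP yz; apply/asboolP.
by apply: eq_null (nullD xy yz) => N; rewrite addrA subrK.
Qed.

Canonical bseq_equiv :=
  EquivRel bseq_eqv bseq_eqv_refl bseq_eqv_sym bseq_eqv_trans.

Definition asymp := {eq_quot bseq_equiv}.
HB.instance Definition _ := Choice.on asymp.

Definition cls (x : bseq) : asymp := \pi x.
Definition rep (a : asymp) : bseq := repr a.

Lemma repK a : cls (rep a) = a. Proof. exact: reprK. Qed.

Lemma clsP (x y : bseq) : cls x = cls y <-> null (fun N => x N - y N).
Proof.
by split => [/eqmodP/asboolP|xy] //; apply/eqmodP; apply/asboolP.
Qed.

Lemma eq_cls (x y : bseq) : (forall N, x N = y N) -> cls x = cls y.
Proof.
by move=> xy; apply/clsP; apply: (eq_null (x := fun N => x N - x N)) => [N|];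
  [rewrite xy|exact/asboolP/bseq_eqv_refl].
Qed.

Lemma rep_cls x : null (fun N => rep (cls x) N - x N).
Proof. by apply/clsP; rewrite repK. Qed.

Fact bzero_subproof : exists r, 0 <= r /\ evbound (fun N => 0 : 'M[R[i]]_((q N).+1)) r.
Proof. by exists 0; split => //; exists 0 => N _; exact: opbound0. Qed.
Definition bzero := BSeq bzero_subproof.

Fact bone_subproof : exists r, 0 <= r /\ evbound (fun N => 1%:M : 'M[R[i]]_((q N).+1)) r.
Proof. by exists 1; split => //; exists 0 => N _; exact: opbound1. Qed.
Definition bone := BSeq bone_subproof.

Fact badd_subproof (x y : bseq) :
  exists r, 0 <= r /\ evbound (fun N => x N + y N) r.
Proof.
have [[r [r0 xr]] [s [s0 ys]]] := (bvalP x, bvalP y).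
by exists (r + s); split; [exact: addr_ge0|exact: evboundD].
Qed.
Definition badd x y := BSeq (badd_subproof x y).

Fact bopp_subproof (x : bseq) : exists r, 0 <= r /\ evbound (fun N => - x N) r.
Proof. by have [r [r0 xr]] := bvalP x; exists r; split => //; exact: evboundN. Qed.
Definition bopp x := BSeq (bopp_subproof x).

Fact bmul_subproof (x y : bseq) :
  exists r, 0 <= r /\ evbound (fun N => x N *m y N) r.
Proof.
have [[r [r0 xr]] [s [s0 ys]]] := (bvalP x, bvalP y).
by exists (r * s); split; [exact: mulr_ge0|exact: evboundM].
Qed.
Definition bmul x y := BSeq (bmul_subproof x y).

Fact bscale_subproof c (x : bseq) :
  exists r, 0 <= r /\ evbound (fun N => c *: x N) r.
Proof.
have [r [r0 xr]] := bvalP x; exists (normc c * r).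
by split; [rewrite mulr_ge0 ?normc_ge0|exact: evboundZ].
Qed.
Definition bscale c x := BSeq (bscale_subproof c x).

Fact badj_subproof (x : bseq) : exists r, 0 <= r /\ evbound (fun N => (x N)^t*) r.
Proof.
by have [r [r0 xr]] := bvalP x; exists r; split => //; exact: evbound_adj.
Qed.
Definition badj x := BSeq (badj_subproof x).

(** The operations act on chosen representatives; the lemmas [asaddE] to [asstarE] show that every
    representative gives the same class. *)
Definition asadd a b := cls (badd (rep a) (rep b)).
Definition asopp a := cls (bopp (rep a)).
Definition asmul a b := cls (bmul (rep a) (rep b)).
Definition asscale c a := cls (bscale c (rep a)).
Definition asstar a := cls (badj (rep a)).

Lemma asaddE x y : asadd (cls x) (cls y) = cls (badd x y).
Proof.
apply/clsP; apply: eq_null (nullD (rep_cls x) (rep_cls y)) => N /=.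
by rewrite opprD addrACA.
Qed.

Lemma asoppE x : asopp (cls x) = cls (bopp x).
Proof.
by apply/clsP; apply: eq_null (nullN (rep_cls x)) => N /=; rewrite opprB opprK addrC.
Qed.

(** With [x'], [y'] the chosen representatives, [x' y' - x y = x' (y' - y) + (x' - x) y], and a
    bounded sequence times a null one is null. *)
Lemma asmulE x y : asmul (cls x) (cls y) = cls (bmul x y).
Proof.
have [[r [r0 xr]] [s [s0 ys]]] := (bvalP (rep (cls x)), bvalP y).
apply/clsP; apply: eq_null
  (nullD (nullMl r0 xr (rep_cls y)) (nullMr s0 ys (rep_cls x))) => N /=.
by rewrite mulmxBr mulmxBl addrA subrK.
Qed.

Lemma asscaleE c x : asscale c (cls x) = cls (bscale c x).
Proof.
by apply/clsP; apply: eq_null (nullZ c (rep_cls x)) => N /=; rewrite scalerBr.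
Qed.

Lemma asstarE x : asstar (cls x) = cls (badj x).
Proof.
apply/clsP; apply: eq_null (null_adj (rep_cls x)) => N /=.
by rewrite linearB map_mxB.
Qed.

Lemma asaddA : associative asadd.
Proof.
move=> a b c; rewrite -(repK a) -(repK b) -(repK c) !asaddE.
by apply: eq_cls => N /=; rewrite addrA.
Qed.

Lemma asaddC : commutative asadd.
Proof.
move=> a b; rewrite -(repK a) -(repK b) !asaddE.
by apply: eq_cls => N /=; rewrite addrC.
Qed.

Lemma asadd0 : left_id (cls bzero) asadd.
Proof.
move=> a; rewrite -(repK a) asaddE.
by apply: eq_cls => N /=; rewrite add0r.
Qed.

Lemma asaddN : left_inverse (cls bzero) asopp asadd.
Proof.
move=> a; rewrite -(repK a) asoppE asaddE.
by apply: eq_cls => N /=; rewrite addNr.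
Qed.

HB.instance Definition _ := GRing.isZmodule.Build asymp
  asaddA asaddC asadd0 asaddN.

Lemma asmulA : associative asmul.
Proof.
move=> a b c; rewrite -(repK a) -(repK b) -(repK c) !asmulE.
by apply: eq_cls => N /=; rewrite mulmxA.
Qed.

Lemma asmul1l : left_id (cls bone) asmul.
Proof.
move=> a; rewrite -(repK a) asmulE.
by apply: eq_cls => N /=; rewrite mul1mx.
Qed.

Lemma asmul1r : right_id (cls bone) asmul.
Proof.
move=> a; rewrite -(repK a) asmulE.
by apply: eq_cls => N /=; rewrite mulmx1.
Qed.

Lemma asmulDl : left_distributive asmul asadd.
Proof.
move=> a b c; rewrite -(repK a) -(repK b) -(repK c) !(asmulE, asaddE).
by apply: eq_cls => N /=; rewrite mulmxDl.
Qed.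

Lemma asmulDr : right_distributive asmul asadd.
Proof.
move=> a b c; rewrite -(repK a) -(repK b) -(repK c) !(asmulE, asaddE).
by apply: eq_cls => N /=; rewrite mulmxDr.
Qed.

Lemma asone_neq0 : cls bone != cls bzero.
Proof.
apply/eqP => /clsP /(_ (1 / 2)) [|N0 /(_ _ (leqnn _))]; first by lra.
(* The size [(q N0).+1] is positive, so there is a basis vector, which the identity cannot shrink by
   half. *)
rewrite subr0 => /(_ (delta_mx 0 0)); rewrite mulmx1 => le_half.
have /l2norm_eq0/matrixP/(_ 0 0) : l2norm (delta_mx 0 0 : 'rV[R[i]]_((q N0).+1)) = 0.
  by have := l2norm_ge0 (delta_mx 0 0 : 'rV[R[i]]_((q N0).+1)); lra.
by rewrite !mxE eqxx /= => /eqP; rewrite oner_eq0.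
Qed.

HB.instance Definition _ := GRing.Zmodule_isNzRing.Build asymp
  asmulA asmul1l asmul1r asmulDl asmulDr asone_neq0.

Lemma asscaleA c d a : asscale c (asscale d a) = asscale (c * d) a.
Proof.
rewrite -(repK a) !asscaleE.
by apply: eq_cls => N /=; rewrite scalerA.
Qed.

Lemma asscale1 : left_id 1 asscale.
Proof.
move=> a; rewrite -(repK a) asscaleE.
by apply: eq_cls => N /=; rewrite scale1r.
Qed.

Lemma asscaleDr : right_distributive asscale +%R.
Proof.
move=> c a b; rewrite -(repK a) -(repK b); move: (rep a) (rep b) => x y.
rewrite [cls x + cls y]asaddE !asscaleE [RHS]asaddE.
by apply: eq_cls => N /=; rewrite scalerDr.
Qed.

Lemma asscaleDl a : {morph asscale^~ a : c d / c + d}.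
Proof.
move=> c d; rewrite -(repK a) !asscaleE [RHS]asaddE.
by apply: eq_cls => N /=; rewrite scalerDl.
Qed.

HB.instance Definition _ := GRing.Zmodule_isLmodule.Build R[i] asymp
  asscaleA asscale1 asscaleDr asscaleDl.

Lemma asscaleAl c a b : asscale c (asmul a b) = asmul (asscale c a) b.
Proof.
rewrite -(repK a) -(repK b) !(asmulE, asscaleE).
by apply: eq_cls => N /=; rewrite scalemxAl.
Qed.

Lemma asscaleAr c a b : asscale c (asmul a b) = asmul a (asscale c b).
Proof.
rewrite -(repK a) -(repK b) !(asmulE, asscaleE).
by apply: eq_cls => N /=; rewrite scalemxAr.
Qed.

HB.instance Definition _ := GRing.Lmodule_isLalgebra.Build R[i] asymp asscaleAl.
HB.instance Definition _ := GRing.Lalgebra_isAlgebra.Build R[i] asymp asscaleAr.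

End AsymptoticQuotient.

(** * Norm, involution and completeness of the quotient *)

Section AsymptoticCStar.
Variables (R : realType) (q : nat -> nat).
Local Notation asymp := (asymp R q).
Implicit Types (x y : bseq R q) (a b : asymp).

Definition cn a : R := asnorm (rep a).

Lemma cn_ge0 a : 0 <= cn a. Proof. exact/asnorm_ge0/bvalP. Qed.

Lemma cn_le x r : 0 <= r -> evbound x r -> cn (cls x) <= r.
Proof.
move=> r0 xr; apply/ler_addgt0Pl => e e0; apply: asnorm_le; first lra.
apply: (evbound_eventually (x := fun N => (rep (cls x) N - x N) + x N)).
  by exists 0 => N _; rewrite subrK.
by apply: evboundD => //; exact: rep_cls.
Qed.

Lemma cn_lt x r : cn (cls x) < r -> evbound x r.
Proof.
move=> xr; have [s /andP[xs sr]] : exists s, cn (cls x) < s < r.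
  by exists ((cn (cls x) + r) / 2); rewrite midf_lt // midf_lt.
have e0 : 0 < r - s by rewrite subr_gt0.
apply: (evbound_eventually (x := fun N => rep (cls x) N - (rep (cls x) N - x N))).
  by exists 0 => N _; rewrite opprB addrC subrK.
rewrite (_ : r = s + (r - s)); last by rewrite addrC subrK.
by apply: evboundB; [apply: asnorm_lt xs; exact: bvalP|exact: rep_cls].
Qed.

Lemma asymp_addE x y : cls x + cls y = cls (badd x y). Proof. exact: asaddE. Qed.
Lemma asymp_oppE x : - cls x = cls (bopp x). Proof. exact: asoppE. Qed.
Lemma asymp_mulE x y : cls x * cls y = cls (bmul x y). Proof. exact: asmulE. Qed.
Lemma asymp_scaleE c x : c *: cls x = cls (bscale c x). Proof. exact: asscaleE. Qed.
Lemma asymp_zeroE : 0 = cls (bzero R q). Proof. by []. Qed.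

Lemma asymp_subE x y : cls x - cls y = cls (badd x (bopp y)).
Proof. by rewrite asymp_oppE asymp_addE. Qed.

Lemma cn_eq0 a : cn a = 0 -> a = 0.
Proof.
rewrite -(repK a) asymp_zeroE => cn0; apply/clsP => r r0 /=.
apply: (evbound_eventually (x := rep a)); first by exists 0 => N _; rewrite subr0.
by apply: cn_lt; rewrite cn0.
Qed.

(* Names the norm by a variable: [lra] would otherwise try to unify quotient
   classes while collecting its atoms. *)
Lemma cnP x :
  exists s, [/\ cn (cls x) = s, 0 <= s & forall e, 0 < e -> evbound x (s + e)].
Proof.
exists (cn (cls x)); split=> // [|e e0]; first exact: cn_ge0.
by apply: cn_lt; rewrite ltrDl.
Qed.

Lemma cnD a b : cn (a + b) <= cn a + cn b.
Proof.
rewrite -(repK a) -(repK b) asymp_addE; move: (rep a) (rep b) => x y.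
have [[s [-> s0 xs]] [t [-> t0 yt]]] := (cnP x, cnP y).
apply/ler_addgt0Pl => e e0; have e20 : 0 < e / 2 by rewrite divr_gt0.
have -> : e + (s + t) = (s + e / 2) + (t + e / 2) by lra.
by apply: cn_le => /=; [lra|apply: evboundD; [apply: xs|apply: yt]].
Qed.

Lemma cnZ_le c a : cn (c *: a) <= normc c * cn a.
Proof.
rewrite -(repK a) asymp_scaleE; move: (rep a) => x.
have [[s [-> s0 xs]] c0] := (cnP x, normc_ge0 c).
apply/ler_addgt0Pl => e e0.
have ce : 0 < e / (normc c + 1) by rewrite divr_gt0 //; lra.
apply: (@le_trans _ _ (normc c * (s + e / (normc c + 1)))).
  apply: cn_le; first by rewrite mulr_ge0 //; lra.
  by apply: evboundZ; apply: xs.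
by rewrite mulrDr addrC lerD2r mulr_divS_le.
Qed.

(** For nonzero [c], the reverse inequality is [cnZ_le] for the inverse of [c]. *)
Lemma cnZ c a : cn (c *: a) = normc c * cn a.
Proof.
apply/eqP; rewrite eq_le cnZ_le /=.
have [->|c0] := eqVneq c 0.
  by rewrite ComplexField.Normc.normc0 mul0r cn_ge0.
have nc0 : 0 < normc c.
  rewrite lt_def normc_ge0 andbT; apply: contraNneq c0.
  by move/ComplexField.Normc.eq0_normc ->.
rewrite -[X in normc c * cn X](scalerK c0) -ler_pdivlMl //.
by rewrite -ComplexField.Normc.normcV cnZ_le.
Qed.

Lemma cnM a b : cn (a * b) <= cn a * cn b.
Proof.
rewrite -(repK a) -(repK b) asymp_mulE; move: (rep a) (rep b) => x y.
have [[s [-> s0 xs]] [t [-> t0 yt]]] := (cnP x, cnP y).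
(* [d] is chosen so that [(s + d) * (t + d)] exceeds [s * t] by [d * (s + t + d)], which is at most
   [d * (s + t + 1) <= e]. *)
apply/ler_addgt0Pl => e e0; pose d := Num.min 1 (e / (s + t + 1)).
have d0 : 0 < d by rewrite lt_min ltr01 divr_gt0 //; lra.
have d1 : d <= 1 by rewrite ge_min lexx.
have de : d * (s + t + 1) <= e.
  by rewrite -ler_pdivlMr ?ge_min ?lexx ?orbT //; lra.
apply: (@le_trans _ _ ((s + d) * (t + d))).
  apply: cn_le; first by rewrite mulr_ge0 //; lra.
  by apply: evboundM; [lra|exact: xs|exact: yt].
have -> : (s + d) * (t + d) = d * (s + t + d) + s * t by ring.
by rewrite lerD2r (le_trans _ de) // ler_pM2l //; lra.
Qed.

Lemma asstarK : involutive (@asstar R q).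
Proof.
move=> a; rewrite -(repK a) !asstarE; apply: eq_cls => N /=; exact: trmxCK.
Qed.

Lemma asstarD a b : asstar (a + b) = asstar a + asstar b.
Proof.
rewrite -(repK a) -(repK b); move: (rep a) (rep b) => x y.
rewrite asymp_addE !asstarE asymp_addE; apply: eq_cls => N /=.
by rewrite linearD map_mxD.
Qed.

Lemma asstarZ c a : asstar (c *: a) = (c^*)%C *: asstar a.
Proof.
rewrite -(repK a); move: (rep a) => x.
rewrite asymp_scaleE !asstarE asymp_scaleE; apply: eq_cls => N /=.
by rewrite linearZ map_mxZ.
Qed.

Lemma asstarM a b : asstar (a * b) = asstar b * asstar a.
Proof.
rewrite -(repK a) -(repK b); move: (rep a) (rep b) => x y.
rewrite asymp_mulE !asstarE asymp_mulE; apply: eq_cls => N /=.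
by rewrite trmx_mul map_mxM.
Qed.

Lemma cn_asstar_le a : cn (asstar a) <= cn a.
Proof.
rewrite -(repK a) asstarE; move: (rep a) => x; have [s [-> s0 xs]] := cnP x.
apply/ler_addgt0Pl => e e0; rewrite addrC; apply: cn_le; first lra.
by apply: evbound_adj; [lra|exact: xs].
Qed.

Lemma cn_asstar a : cn (asstar a) = cn a.
Proof.
have ge_cn := cn_asstar_le (asstar a); rewrite asstarK in ge_cn.
by apply: le_anti; apply/andP; split; first exact: cn_asstar_le.
Qed.

(** One inequality is submultiplicativity. For the other, writing [a] as [asstar b] gives the
    product the order [b * asstar b] expected by [evbound_cstar], and the square root of a bound for
    it bounds [b]. *)
Lemma cn_cstar a : cn (asstar a * a) = cn a ^+ 2.
Proof.
apply: le_anti; apply/andP; split.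
  by apply: le_trans (cnM _ _) _; rewrite cn_asstar expr2.
rewrite -cn_asstar; move: (asstar a) (asstarK a) => b <-.
rewrite -(repK b) asstarE asymp_mulE; move: (rep b) => x.
have [s [-> s0 xs]] := cnP (bmul x (badj x)).
apply/ler_addgt0Pl => e e0.
have se0 : 0 <= e + s by lra.
rewrite -[e + s]sqr_sqrtr // ler_pXn2r ?nnegrE ?cn_ge0 ?sqrtr_ge0 //.
apply: cn_le; first exact: sqrtr_ge0.
apply: evbound_cstar; first exact: sqrtr_ge0.
by rewrite sqr_sqrtr // addrC; exact: xs.
Qed.

Lemma cn_sub_lt x y r : cn (cls x - cls y) < r -> evbound (fun N => x N - y N) r.
Proof. by rewrite asymp_subE => /cn_lt. Qed.

(* Diagonal argument: [y i] is within [1/(i+1)] of the tail of [s], so some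
   coordinatewise choice [l N] is eventually close to every [y i N]. *)
Lemma cn_complete (s : nat -> asymp) :
  (forall eps : R, 0 < eps -> exists N : nat, forall m n : nat,
     (N <= m)%N -> (N <= n)%N -> cn (s m - s n) < eps) ->
  exists l : asymp, forall eps : R, 0 < eps -> exists N : nat, forall n : nat,
     (N <= n)%N -> cn (s n - l) < eps.
Proof.
move=> cau.
have del_gt0 i : 0 < i.+1%:R^-1 :> R by rewrite invr_gt0 ltr0n.
have del_le i j : (i <= j)%N -> j.+1%:R^-1 <= i.+1%:R^-1 :> R.
  by move=> ij; rewrite lef_pV2 ?posrE ?ltr0n // ler_nat.
have /choice[M HM] : forall i, exists M, forall m n : nat,
    (M <= m)%N -> (M <= n)%N -> cn (s m - s n) < i.+1%:R^-1.
  by move=> i; exact: cau.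
pose y i := rep (s (M i)).
have yE i : cls (y i) = s (M i) by exact: repK.
have y_close i j : (i <= j)%N ->
    evbound (fun N => y i N - y j N) (2 * i.+1%:R^-1).
  move=> ij; apply: cn_sub_lt; rewrite !yE.
  pose m := maxn (M i) (M j).
  rewrite -(subrK (s m) (s (M i))) -addrA (le_lt_trans (cnD _ _)) //.
  rewrite mulr2n mulrDl mul1r ltrD //; first by rewrite HM // leq_maxl.
  by apply: lt_le_trans (del_le _ _ ij); rewrite HM // leq_maxr.
have /choice[K HK] : forall i, exists K : nat -> nat, forall j, (i <= j)%N ->
    forall N, (K j <= N)%N -> opbound (y i N - y j N) (2 * i.+1%:R^-1).
  move=> i; have /choice[k Hk] : forall j, exists k, (i <= j)%N ->
      forall N, (k <= N)%N -> opbound (y i N - y j N) (2 * i.+1%:R^-1).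
    move=> j; have [ij|ij] := leqP i j; last by exists 0%N.
    by have [k Hk] := y_close _ _ ij; exists k.
  by exists k.
(* The maximum makes [L j] a valid threshold against every [i <= j]; the summand [j] leaves only
   finitely many [i] with [L i <= N]. *)
pose L j := (j + \max_(i < j.+1) K i j)%N.
have KL i j : (i <= j)%N -> (K i j <= L j)%N.
  move=> ij; rewrite (leq_trans _ (leq_addl _ _)) //.
  exact: (leq_bigmax (F := fun i : 'I_j.+1 => K i j) (Ordinal (ltnSE ij : (i < j.+1)%N))).
have ex_l : forall N, exists l : 'M[R[i]]_((q N).+1),
    forall i, (L i <= N)%N -> opbound (y i N - l) (2 * i.+1%:R^-1).
  move=> N; have [[i0 Hi0]|no] := pselect (exists i, (L i <= N)%N); last first.
    by exists 0 => i Li; case: no; exists i.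
  have bnd i : (L i <= N)%N -> (i <= N)%N by apply: leq_trans; exact: leq_addr.
  (* At coordinate [N] the limit is [y j N] for the largest admissible [j], which is then close to
     all [y i N] with [i] admissible. *)
  have [j Lj max_j] := ex_maxnP (ex_intro _ i0 Hi0) bnd.
  by exists (y j N) => i /[dup] Li /max_j ij; apply: HK => //; apply: leq_trans Lj; exact: KL.
pose l N := projT1 (cid (ex_l N)).
have Hl N : forall i, (L i <= N)%N -> opbound (y i N - l N) (2 * i.+1%:R^-1).
  exact: projT2 (cid (ex_l N)).
have yl i : evbound (fun N => y i N - l N) (2 * i.+1%:R^-1).
  by exists (L i) => N; exact: Hl.
have lP : exists r, 0 <= r /\ evbound l r.
  have [r [r0 yr]] := bvalP (y 0); exists (r + 2 * 1%:R^-1); split.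
    by rewrite addr_ge0 // mulr_ge0 // ltW.
  apply: (evbound_eventually (x := fun N => y 0 N - (y 0 N - l N))).
    by exists 0 => N _; rewrite opprB addrC subrK.
  exact: evboundB.
exists (cls (BSeq lP)) => eps eps0.
(* Of the three parts, one pays for [s n] against [s (M i)] and two for [y i] against [l]. *)
have [i Hi] : exists i, 3 * i.+1%:R^-1 < eps.
  have e3 : 0 < 3 / eps by rewrite divr_gt0.
  have Hk := archi_boundP (ltW e3); exists (Num.bound (3 / eps)).
  rewrite ltr_pdivrMr ?ltr0n // mulrC -ltr_pdivrMr //.
  by apply: lt_trans Hk _; rewrite ltr_nat.
exists (M i) => n Mn; apply: le_lt_trans Hi.
rewrite -(subrK (s (M i)) (s n)) -addrA (le_trans (cnD _ _)) //.
rewrite (_ : 3 * _ = i.+1%:R^-1 + 2 * i.+1%:R^-1); last by ring.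
rewrite lerD //; first by rewrite ltW // HM.
rewrite -yE asymp_subE; apply: cn_le; first by rewrite mulr_ge0 // ltW.
exact: yl.
Qed.

HB.instance Definition _ := isUnitalCStar.Build R asymp
  cn_eq0 cnD cnZ cnM cn_complete asstarK asstarD asstarZ asstarM cn_cstar.

End AsymptoticCStar.

(** * Ranks of almost orthogonal idempotents *)

Section IdempotentMatrices.
Variables (R : realType) (q : nat).
Implicit Types (x p g h : 'M[R[i]]_q) (r : R).

Lemma normal_diagonalization x : x *m x^t* = x^t* *m x ->
  exists u w : 'M[R[i]]_q, exists2 d, x = w *m diag_mx d *m u &
    [/\ u *m w = 1%:M, w *m u = 1%:M, opbound u 1 & opbound w 1].
Proof.
move=> /eqP x_norm; have /orthomx_spectralP xE : x \is normalmx by [].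
have Su := spectral_unitarymx x; have SS := unitarymxP Su.
exists (spectralmx x), ((spectralmx x)^t*); exists (spectral_diag x).
  by rewrite {1}xE invmx_unitary.
have S1 := opbound_unitary SS.
split=> //; last exact: opbound_adj.
by rewrite -invmx_unitary // mulVmx // spectral_unit.
Qed.

Lemma opbound_diag_entry (d : 'rV[R[i]]_q) r j :
  opbound (diag_mx d) r -> normc (d 0 j) <= r.
Proof.
pose v : 'rV[R[i]]_q := delta_mx 0 j; move=> /(_ v).
have -> : v *m diag_mx d = d 0 j *: v.
  apply/rowP => k; rewrite mul_mx_diag !mxE eqxx /=.
  by have [->|] := eqVneq k j; rewrite ?mul1r ?mulr1 // mul0r mulr0.
rewrite l2normZ; rewrite ler_pM2r // lt_def l2norm_ge0 andbT.
apply/eqP => /l2norm_eq0/matrixP/(_ 0 j); rewrite !mxE !eqxx /=.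
by move/eqP; rewrite oner_eq0.
Qed.

(* Round the eigenvalues: [|l ^+ 2 - l| <= r] puts [l] within [2 r] of 0 or 1. *)
Lemma idempotent_near x : x *m x^t* = x^t* *m x ->
  exists2 p, p *m p = p &
    forall r, 0 <= r -> opbound (x *m x - x) r -> opbound (p - x) (2 * r).
Proof.
move=> /normal_diagonalization[u [w [d -> [uw wu u1 w1]]]].
pose c := \row_j (if normc (d 0 j - 1) < 2^-1 then 1 else 0 : R[i]).
have conjM (e f : 'rV[R[i]]_q) : w *m diag_mx e *m u *m (w *m diag_mx f *m u) =
    w *m diag_mx (\row_j (e 0 j * f 0 j)) *m u.
  rewrite -!mulmxA (mulmxA u) uw mul1mx (mulmxA (diag_mx e)) mulmx_diag.
  by [].
have conjB (e f : 'rV[R[i]]_q) : w *m diag_mx e *m u - w *m diag_mx f *m u =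
    w *m diag_mx (e - f) *m u.
  rewrite -mulmxBl -mulmxBr; congr (_ *m _ *m _).
  by apply/matrixP => i j; rewrite !mxE mulrnBl.
exists (w *m diag_mx c *m u).
  rewrite conjM; congr (_ *m diag_mx _ *m _); apply/rowP => j; rewrite !mxE.
  by case: ifP; rewrite ?mulr1 ?mulr0.
move=> r r0; rewrite conjM !conjB; set e := _ - d => le_r.
have e_r : opbound (diag_mx e) r.
  have -> : diag_mx e = u *m (w *m diag_mx e *m u) *m w.
    by rewrite !mulmxA uw mul1mx -mulmxA uw mulmx1.
  rewrite -[r]mulr1 -[r]mul1r.
  by apply: opboundM => //; apply: opboundM.
rewrite -[2 * r]mulr1 -[2 * r]mul1r.
apply: opboundM => //; apply: opboundM; rewrite ?mulr_ge0 //.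
apply: opbound_diag => [|j]; first by rewrite mulr_ge0.
have := opbound_diag_entry j e_r; rewrite !mxE.
have -> : d 0 j * d 0 j - d 0 j = d 0 j * (d 0 j - 1) by ring.
rewrite ComplexField.Normc.normcM.
have := normc_ge0 (d 0 j); have := normc_ge0 (d 0 j - 1).
(* Of the factors [d 0 j] and [d 0 j - 1] the one not being rounded away has modulus at least 1/2;
   their product is at most [r], so the other is at most [2 * r]. *)
case: ltP => [lt_half _ _|ge_half _ d0 le_dr]; last first.
  rewrite sub0r normcN; nra.
have := le_normcD (1 - d 0 j) (d 0 j).
rewrite subrK ComplexField.Normc.normc1 -(normcN (1 - _)) opprB; nra.
Qed.

(* If [v] lies in the row space of [p] and [v g p' = 0], then
   [v = v (1 - g h) + v (p g - g p') h] is shorter than itself. *)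
Lemma rank_intertwined p p' g h (a b c : R) :
  p *m p = p -> 0 <= c -> a * c + b < 1 ->
  opbound (p *m g - g *m p') a -> opbound (1%:M - g *m h) b -> opbound h c ->
  (\rank p <= \rank p')%N.
Proof.
move=> pp c0 abc pg gh hc.
(* Rank-nullity on the row space of [p]: if it meets the kernel of [g *m p'] trivially, then [p] has
   the rank of [p *m g *m p']. *)
suff p_cap : (p :&: kermx (g *m p') = 0)%MS.
  rewrite -(mxrank_mul_ker p (g *m p')) p_cap mxrank0 addn0 mulmxA.
  exact: mxrankM_maxr.
apply/eqP/rowV0P => v; rewrite sub_capmx => /andP[/submxP[w vE] /sub_kermxP vk].
have vp : v *m p = v by rewrite vE -mulmxA pp.
apply: (opbound_contract_eq0 abc); rewrite [X in l2norm X <= _](_ : v =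
  v *m ((p *m g - g *m p') *m h + (1%:M - g *m h))); last first.
  rewrite mulmxDr !mulmxBl !mulmxBr mulmx1 !mulmxA vp -(mulmxA v g p') vk mul0mx.
  by rewrite subr0 addrC subrK.
by apply: opboundD => //; exact: opboundM.
Qed.

(** If vectors [v j] in the row spaces sum to 0, then [v j] is minus the sum of the
    [v i *m (p i *m p j)] over [i != j]. So each length is at most [a] times the total length, and
    [a *+ n < 1] makes the total 0: the row spaces are independent. They span because a matrix at
    distance [b < 1] from the identity has trivial kernel. *)
Lemma rank_sum_idempotents n (p : 'I_n -> 'M[R[i]]_q) (a b : R) :
  (forall j, p j *m p j = p j) -> 0 <= a -> a *+ n < 1 -> b < 1 ->
  (forall i j, i != j -> opbound (p i *m p j) a) ->
  opbound (1%:M - \sum_j p j) b -> (\sum_j \rank (p j) = q)%N.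
Proof.
move=> pp a0 an b1 pa pb.
have indep (v : 'I_n -> 'rV[R[i]]_q) : (forall j, v j *m p j = v j) ->
    \sum_j v j = 0 -> forall j, v j = 0.
  move=> vp v0; pose S := \sum_j l2norm (v j).
  have S0 : 0 <= S by apply: sumr_ge0 => j _; exact: l2norm_ge0.
  have le_S j : l2norm (v j) <= a * S.
    have -> : v j = - \sum_(i | i != j) v i *m (p i *m p j).
      apply/eqP; rewrite -addr_eq0 -[X in X + _]vp.
      rewrite [X in _ + X](eq_bigr (fun i => v i *m p j)); last first.
        by move=> i _; rewrite mulmxA vp.
      have : \sum_i v i *m p j = 0 by rewrite -mulmx_suml v0 mul0mx.
      by rewrite (bigD1 j) //= => ->.
    rewrite l2normN; apply: le_trans (_ : \sum_(i | i != j) l2norm (v i *m (p i *m p j)) <= _).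
      elim/big_rec2: _ => [|i y z _ le_zy]; first by rewrite l2norm0.
      by apply: le_trans (l2normD _ _) _; rewrite lerD2l.
    apply: (@le_trans _ _ (\sum_(i | i != j) a * l2norm (v i))).
      by apply: ler_sum => i ij; exact: pa.
    have -> : S = l2norm (v j) + \sum_(i | i != j) l2norm (v i).
      by rewrite /S (bigD1 j).
    by rewrite -mulr_sumr; apply: ler_wpM2l => //; rewrite lerDr l2norm_ge0.
  have S_eq0 : S = 0.
    apply: le_anti; rewrite S0 andbT.
    have : S <= \sum_(j < n) a * S by apply: ler_sum => j _; exact: le_S.
    rewrite sumr_const card_ord -mulrnAl => le_SS.
    move: (a *+ n) an le_SS => c c1 le_SS; nra.
  move=> j; apply: l2norm_eq0; apply: le_anti; rewrite l2norm_ge0 andbT.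
  by apply: le_trans (le_S j) _; rewrite S_eq0 mulr0.
have full : \rank (\sum_j p j)%MS = q.
  apply/eqP; rewrite eqn_leq rank_leq_col /=.
  have /eqP rk : row_free (\sum_j p j)%R.
    rewrite -kermx_eq0; apply/rowV0P => v /sub_kermxP v0.
    apply: (opbound_contract_eq0 b1); rewrite [X in l2norm X <= _](_ : v =
      v *m (1%:M - \sum_j p j)) //.
    by rewrite mulmxBr mulmx1 v0 subr0.
  rewrite -[X in (X <= _)%N]rk; apply: mxrankS; apply: summx_sub => j _.
  exact: sumsmx_sup (submx_refl _).
rewrite -[RHS]full; apply/esym/eqP; rewrite -[_ == _]/(mxdirect _).
apply/mxdirect_sumsP => /= j _; apply/eqP/rowV0P => v; rewrite sub_capmx.
case/andP => /submxP[w vE] /sub_sumsmxP[z vz].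
(* A vector common to row space [j] and the sum of the others becomes a family of vectors with sum
   0. *)
pose t i := if i == j then v else - (z i *m p i).
have := indep t; rewrite /t => /(_ _ _ j); rewrite eqxx; apply.
  move=> i; case: eqVneq => [->|_]; last by rewrite mulNmx -mulmxA pp.
  by rewrite vE -mulmxA pp.
rewrite (bigD1 j) //= eqxx (eq_bigr (fun i => - (z i *m p i))).
  by rewrite sumrN -vz subrr.
by move=> i /negPf ->.
Qed.

End IdempotentMatrices.

(** * Lifting projections and comparing their ranks *)

Section AsymptoticProjections.
Variables (R : realType) (q : nat -> nat).
Local Notation asymp := (asymp R q).
Implicit Types (x y : bseq R q) (a b f : asymp).

Lemma finite_eventually (I : finType) (P : I -> nat -> Prop) :
  (forall i, exists N0, forall N, (N0 <= N)%N -> P i N) ->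
  exists N0, forall N, (N0 <= N)%N -> forall i, P i N.
Proof.
move=> /choice[K HK]; exists (\max_i K i)%N => N KN i; apply: HK.
by apply: leq_trans KN; exact: leq_bigmax.
Qed.

Lemma cls_sum (I : Type) (s : seq I) (x : I -> bseq R q) :
  exists2 y, cls y = \sum_(i <- s) cls (x i) &
    forall N, y N = \sum_(i <- s) x i N.
Proof.
elim: s => [|i s [y yE yN]].
  by exists (bzero R q) => [|N]; rewrite big_nil.
exists (badd (x i) y) => [|N] /=; rewrite big_cons -?yN //.
by rewrite -asymp_addE yE.
Qed.

(** Averaging a representative with its adjoint gives self-adjoint, hence normal, matrices [h N]
    with [h N *m h N - h N] null; rounding their eigenvalues changes them by a null sequence. *)
Lemma lift_projection f : projection f ->
  exists2 p : bseq R q, cls p = f & forall N, p N *m p N = p N.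
Proof.
move=> [fs ff]; have half2 : 2^-1 + 2^-1 = 1 :> R[i] by rewrite [RHS]splitr !mul1r.
pose h := bscale 2^-1 (badd (rep f) (badj (rep f))).
have hf : cls h = f.
  rewrite -asymp_scaleE -asymp_addE -(asstarE (rep f)) repK -[asstar f]/(star f) fs.
  by rewrite scalerDr -scalerDl half2 scale1r.
have hN N : (h N)^t* = h N.
  rewrite /= linearZ /= map_mxZ linearD /= map_mxD trmxCK addrC.
  by rewrite fmorphV /= conjC_nat.
have hh : null (fun N => h N *m h N - h N).
  by apply: (clsP (bmul h h) h).1; rewrite -asymp_mulE hf ff.
(* The idempotent is chosen before [r], so that one sequence serves every tolerance. *)
have ex_p N : exists p : 'M[R[i]]_((q N).+1), p *m p = p /\ forall r, 0 <= r ->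
    opbound (h N *m h N - h N) r -> opbound (p - h N) (2 * r).
  have [|p pp ph] := @idempotent_near _ _ (h N); first by rewrite hN.
  by exists p.
pose p N := projT1 (cid (ex_p N)).
have [pp ph] : (forall N, p N *m p N = p N) /\ (forall N r, 0 <= r ->
    opbound (h N *m h N - h N) r -> opbound (p N - h N) (2 * r)).
  by split=> N; have [] := projT2 (cid (ex_p N)).
have p_h : null (fun N => p N - h N).
  move=> r r0; have [N0 HN] := hh (r / 2) (divr_gt0 r0 (ltr0Sn _ _)).
  exists N0 => N /HN; rewrite {2}(_ : r = 2 * (r / 2)); last by field.
  by apply: ph; rewrite divr_ge0 // ltW.
have pP : exists r, 0 <= r /\ evbound p r.
  have [r [r0 hr]] := bvalP h; exists (1 + r); split; first by rewrite addr_ge0.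
  apply: (evbound_eventually (x := fun N => (p N - h N) + h N)).
    by exists 0%N => N _; rewrite subrK.
  by apply: evboundD => //; exact: p_h.
by exists (BSeq pP) => //; rewrite -hf; apply/clsP.
Qed.

Lemma eq_iter_ordS n (i j : 'I_n) : exists m, iter m (@ordS n) i = j.
Proof.
(* [n - i] steps lead from [i] around to 0, and [j] more to [j]. *)
exists (j + (n - i))%N; apply: val_inj.
have iterE m : val (iter m (@ordS n) i) = ((i + m) %% n)%N.
  elim: m => [|m IHm]; first by rewrite addn0 modn_small.
  by rewrite iterS /= IHm -addn1 modnDml addn1 addnS.
rewrite iterE (addnC j) addnA subnKC ?(ltnW (ltn_ord i)) //.
by rewrite modnDl modn_small.
Qed.

Lemma rank_cyclic n (r : 'I_n -> nat) :
  (forall j, (r j <= r (ordS j))%N) -> forall i j, r i = r j.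
Proof.
move=> rS; have le_r i j : (r i <= r j)%N.
  have [m <-] := eq_iter_ordS i j; elim: m => //= m; move/leq_trans; exact.
by move=> i j; apply/eqP; rewrite eqn_leq !le_r.
Qed.

(** For large [N] the intertwiners give rank inequalities from each lifted idempotent to its
    successor; around the cycle these are equalities, so [n] times the common rank is the matrix
    size. *)
Lemma intertwined_partition_dvd n (f : 'I_n -> asymp) :
  (forall j, projection (f j)) -> (forall i j, i != j -> f i * f j = 0) ->
  \sum_j f j = 1 ->
  (forall j, exists g h, g * h = 1 /\ f j * g = g * f (ordS j)) ->
  exists N0, forall N, (N0 <= N)%N -> (n %| (q N).+1)%N.
Proof.
move=> fP f0 f1 fg.
have /choice[p Hp] : forall j, exists p : bseq R q,
    cls p = f j /\ forall N, p N *m p N = p N.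
  by move=> j; have [p] := lift_projection (fP j); exists p.
have pE j : cls (p j) = f j by case: (Hp j).
have pp j N : p j N *m p j N = p j N by case: (Hp j).
have ranks : exists N0, forall N, (N0 <= N)%N -> forall j,
    (\rank (p j N) <= \rank (p (ordS j) N))%N.
  apply: finite_eventually => j; have [g [h []]] := fg j.
  rewrite -(repK g) -(repK h) -!pE; move: (rep g) (rep h) => {g h} g h gh pg.
  have [c [c0 hc]] := bvalP h.
  have gh0 : null (fun N => 1%:M - g N *m h N).
    by apply: (clsP (bone R q) (bmul g h)).1; rewrite -asymp_mulE gh.
  have pg0 : null (fun N => p j N *m g N - g N *m p (ordS j) N).
    apply: (clsP (bmul (p j) g) (bmul g (p (ordS j)))).1.
    by rewrite -!asymp_mulE.
  (* With this [a] and [b = 1/4], the quantity [a * c + b] of [rank_intertwined] is at most 3/4. *)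
  have a0 : 0 < 2^-1 / (c + 1) :> R by rewrite divr_gt0 //; lra.
  have [[N1 H1] [N2 H2] [N3 H3]] := And3 (gh0 4^-1 ltac:(lra)) (pg0 _ a0) hc.
  exists (maxn N1 (maxn N2 N3)) => N; rewrite !geq_max => /and3P[n1 n2 n3].
  apply: (rank_intertwined (pp j N) c0 _ (H2 _ n2) (H1 _ n1) (H3 _ n3)).
  rewrite mulrAC; have : 2^-1 * c / (c + 1) <= 2^-1 by rewrite ler_pdivrMr; lra.
  lra.
(* The tolerance [1/(n+1)] is chosen so that [n] copies of it stay below 1. *)
have orth : exists N0, forall N, (N0 <= N)%N -> forall ij : 'I_n * 'I_n,
    ij.1 != ij.2 -> opbound (p ij.1 N *m p ij.2 N) (n.+1%:R^-1).
  apply: finite_eventually => -[i j] /=; have [->|ij] := eqVneq i j.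
    by exists 0%N.
  have p0 : null (fun N => p i N *m p j N - 0).
    apply: (clsP (bmul (p i) (p j)) (bzero R q)).1.
    by rewrite -asymp_mulE !pE f0.
  have [|N0 HN] := p0 n.+1%:R^-1; first by rewrite invr_gt0 ltr0n.
  by exists N0 => N /HN; rewrite subr0.
have total : exists N0, forall N, (N0 <= N)%N ->
    opbound (1%:M - \sum_j p j N) 2^-1.
  have [y yE yN] := cls_sum (index_enum 'I_n) p.
  have y1 : null (fun N => 1%:M - y N).
    by apply: (clsP (bone R q) y).1; rewrite yE (eq_bigr f) // f1.
  by have [|N0 HN] := y1 2^-1; [lra|exists N0 => N /HN; rewrite yN].
have [[N1 H1] [N2 H2] [N3 H3]] := And3 ranks orth total.
exists (maxn N1 (maxn N2 N3)) => N; rewrite !geq_max => /and3P[n1 n2 n3].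
have an : n.+1%:R^-1 *+ n < 1 :> R.
  by rewrite -[X in X < _]mulr_natl ltr_pdivrMr ?ltr0n // mul1r ltr_nat.
have half : 2^-1 < 1 :> R by lra.
have a0 : 0 <= n.+1%:R^-1 :> R by rewrite invr_ge0 ler0n.
have := rank_sum_idempotents (pp^~ N) a0 an half
  (fun i j => H2 _ n2 (i, j)) (H3 _ n3).
have eq_r := rank_cyclic (H1 _ n1).
(* For [n = 0] the empty sum of ranks would be 0, but the matrix size is positive. *)
have [j0 _|no] := pickP (fun _ : 'I_n => true); last first.
  by rewrite big1 // => j; have := no j.
rewrite (eq_bigr (fun=> \rank (p j0 N))) => [|j _]; last exact: eq_r.
by rewrite sum_nat_const card_ord => <-; exact: dvdn_mulr.
Qed.

End AsymptoticProjections.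

(** * Phases and the twisted regular representation of (Z/p)^d *)

Section Phases.
Variable R : realType.
Implicit Types (s t : R).

Lemma expi2piD s t : expi2pi (s + t) = expi2pi s * expi2pi t.
Proof.
rewrite /expi2pi mulrDr cosD sinD; apply/eqP; rewrite eq_complex /=.
by rewrite eqxx /= addrC.
Qed.

Lemma expi2pi0 : expi2pi 0 = 1 :> R[i].
Proof. by rewrite /expi2pi mulr0 cos0 sin0. Qed.

Lemma normc_expi2pi t : normc (expi2pi t) = 1.
Proof. by rewrite /= cos2Dsin2 sqrtr1. Qed.

Lemma expi2piN t : expi2pi (- t) * expi2pi t = 1.
Proof. by rewrite -expi2piD addNr expi2pi0. Qed.

Lemma expi2pi_nat n : expi2pi n%:R = 1 :> R[i].
Proof.
elim: n => [|n IHn]; first exact: expi2pi0.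
rewrite -addn1 natrD expi2piD IHn mul1r /expi2pi mulr1 mulr_natl.
by rewrite cos2pi sin2pi.
Qed.

Lemma expi2pi_int (m : int) : expi2pi m%:~R = 1 :> R[i].
Proof.
case: m => m; first exact: expi2pi_nat.
by have := expi2piN (m.+1%:R : R); rewrite expi2pi_nat mulr1 NegzE mulrNz.
Qed.

(** Since [expi2pi s - expi2pi t] is the unimodular [expi2pi t] times [expi2pi (s - t) - 1],
    continuity of sine and cosine at 0 suffices. *)
Lemma expi2pi_continuous t (e : R) : 0 < e -> exists2 r : R, 0 < r &
  forall s, `|s - t| < r -> normc (expi2pi s - expi2pi t) < e.
Proof.
move=> e0; have e20 : 0 < e / 2 by rewrite divr_gt0.
have /cvgrPdist_lt /(_ _ e20) := @continuous_cos R 0.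
have /cvgrPdist_lt /(_ _ e20) := @continuous_sin R 0.
rewrite cos0 sin0 => /nbhs_ballP[r1 r10 Hsin] /nbhs_ballP[r2 r20 Hcos].
have tp : 0 < 2 * pi :> R by rewrite mulr_gt0 // pi_gt0.
exists (Num.min r1 r2 / (2 * pi)).
  by rewrite divr_gt0 // lt_min; apply/andP.
move=> s; rewrite ltr_pdivlMr // lt_min => /andP[st1 st2].
have h_abs : `|2 * pi * (s - t)| = `|s - t| * (2 * pi).
  by rewrite normrM (gtr0_norm tp) mulrC.
rewrite [X in normc X](_ : _ = expi2pi t * (expi2pi (s - t) - 1)); last first.
  by rewrite mulrBr mulr1 -expi2piD (addrC t) subrK.
rewrite ComplexField.Normc.normcM normc_expi2pi mul1r.
set h := s - t in st1 st2 h_abs *.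
have s_lt : `|sin (2 * pi * h)| < e / 2.
  by have := Hsin (2 * pi * h); rewrite /ball /= !sub0r !normrN h_abs => /(_ st1).
have c_lt : `|1 - cos (2 * pi * h)| < e / 2.
  by have := Hcos (2 * pi * h); rewrite /ball /= !sub0r !normrN h_abs => /(_ st2).
have -> : expi2pi h - 1 =
    Complex (cos (2 * pi * h) - 1) 0 + Complex 0 (sin (2 * pi * h)).
  by apply/eqP; rewrite eq_complex /= subr0 addr0 add0r !eqxx.
apply: le_lt_trans (le_normcD _ _) _.
by rewrite /= !expr0n /= addr0 add0r !sqrtr_sqr distrC; lra.
Qed.

End Phases.

(** * Monomial matrices indexed by a finite set *)

Section MonomialMatrices.
Variables (R : realType) (I : finType) (m : nat) (cardI : #|I| = m).
Implicit Types (c : I -> R[i]) (s : I -> I).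

(** The numbering of [I] passes through the equation [cardI], so that [m] may have the shape
    [(q N).+1] of the matrix sequences. *)
Let idx (a : 'I_m) : I := enum_val (cast_ord (esym cardI) a).
Let rk (x : I) : 'I_m := cast_ord cardI (enum_rank x).

Let rkK : cancel rk idx.
Proof. by move=> x; rewrite /idx /rk cast_ordK enum_rankK. Qed.

Let idxK : cancel idx rk.
Proof. by move=> a; rewrite /idx /rk enum_valK cast_ordKV. Qed.

(* As an operator on row vectors: [delta_x] goes to [c x] times [delta_(s x)]. *)
Definition monomial_mx c s : 'M[R[i]]_m :=
  \matrix_(a, b) (c (idx a) *+ (idx b == s (idx a))).

Lemma monomial_mxM c s c' s' :
  monomial_mx c s *m monomial_mx c' s' =
  monomial_mx (fun x => c x * c' (s x)) (s' \o s).
Proof.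
apply/matrixP => a b; rewrite !mxE (bigD1 (rk (s (idx a)))) //= !mxE rkK eqxx mulr1n.
rewrite big1 ?addr0 => [|k ka]; first by rewrite mulrnAr.
rewrite !mxE; case: eqP => [ks|]; last by rewrite mulr0n mul0r.
by case/eqP: ka; rewrite -ks idxK.
Qed.

Lemma monomial_mx_unitary c s : injective s -> (forall x, normc (c x) = 1) ->
  monomial_mx c s *m (monomial_mx c s)^t* = 1%:M.
Proof.
move=> s_inj c1; apply/matrixP => a b.
rewrite !mxE (bigD1 (rk (s (idx a)))) //= !mxE rkK eqxx mulr1n.
rewrite big1 ?addr0 => [|k ka]; last first.
  rewrite !mxE; case: eqP => [ks|]; last by rewrite mulr0n mul0r.
  by case/eqP: ka; rewrite -ks idxK.
rewrite (inj_eq s_inj) (can_eq idxK); case: eqVneq => [->|_].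
  by rewrite mulr1n [RHS]/= [LHS]mulcJ c1 expr1n.
by rewrite mulr0n rmorph0 mulr0.
Qed.

Lemma monomial_mx_twist c s c' s' (l : R[i]) :
  (forall x, c x * c' (s x) = l * (c' x * c (s' x))) -> s' \o s =1 s \o s' ->
  monomial_mx c s *m monomial_mx c' s' =
  l *: (monomial_mx c' s' *m monomial_mx c s).
Proof.
move=> cl ss; rewrite !monomial_mxM; apply/matrixP => a b; rewrite !mxE.
by rewrite cl -mulrnAr -ss.
Qed.

End MonomialMatrices.

(** * Translations of (Z/p)^d with phases, and modulations *)

Section TwistedTranslations.
Variables (R : realType) (d p : nat) (a : 'I_d -> 'I_d -> int).
Hypothesis p_gt0 : (0 < p)%N.
Local Notation I := {ffun 'I_d -> 'I_p}.
Implicit Types (x : I) (j k l : 'I_d).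

Definition shift k x : I := [ffun l => if l == k then ordS (x l) else x l].

Lemma shift_inj k : injective (shift k).
Proof.
move=> x y /ffunP xy; apply/ffunP => l; have := xy l; rewrite !ffunE.
by case: eqP => // _ /ordS_inj.
Qed.

Lemma shiftC j k x : shift j (shift k x) = shift k (shift j x).
Proof. by apply/ffunP => l; rewrite !ffunE; do 2 case: eqP. Qed.

Definition frac (b : int) : R := b%:~R / p%:R.

(** At the wraparound from [p - 1] to 0 the argument changes by an integer, which [expi2pi]
    ignores. *)
Lemma expi2pi_ordS (b : int) (i : 'I_p) :
  expi2pi (frac b * (ordS i)%:R) = expi2pi (frac b * i%:R) * expi2pi (frac b).
Proof.
have p0 : p%:R != 0 :> R by rewrite pnatr_eq0 -lt0n.
rewrite -expi2piD -[X in _ + X]mulr1 -mulrDr natr1 /=.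
rewrite [in RHS](divn_eq i.+1 p) natrD mulrDr expi2piD.
rewrite (_ : frac b * (i.+1 %/ p * p)%:R = (b * (i.+1 %/ p)%:Z)%:~R).
  by rewrite expi2pi_int mul1r.
by rewrite /frac natrM intrM -pmulrn mulrCA divfK // mulrC.
Qed.

(** Only coordinates [l < j] enter, so of two translations just the one with the larger index sees
    the other, and a single entry of [a] governs their commutation. *)
Definition phase j x : R[i] :=
  \prod_(l < d | (l < j)%N) expi2pi (frac (a j l) * (x l)%:R).

Lemma normc_phase j x : normc (phase j x) = 1.
Proof.
rewrite /phase; elim/big_rec: _ => [|l z _ z1]; first exact: ComplexField.Normc.normc1.
by rewrite ComplexField.Normc.normcM z1 normc_expi2pi mulr1.
Qed.

Lemma phase_shift j k x : phase j (shift k x) =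
  phase j x * (if (k < j)%N then expi2pi (frac (a j k)) else 1).
Proof.
rewrite /phase; case: ifP => kj.
  rewrite (bigD1 k) //= [in RHS](bigD1 k) //= ffunE eqxx expi2pi_ordS.
  rewrite mulrAC; congr (_ * _); congr (_ * _); apply: eq_bigr => l /andP[_ lk].
  by rewrite ffunE (negPf lk).
rewrite mulr1; apply: eq_bigr => l lj; rewrite ffunE.
by case: eqP lj => // ->; rewrite kj.
Qed.

Variables (m : nat) (cardI : #|I| = m).

Definition translation j : 'M[R[i]]_m := monomial_mx cardI (phase j) (shift j).

Lemma translation_unitary j : translation j *m (translation j)^t* = 1%:M.
Proof. exact: monomial_mx_unitary (@shift_inj j) (normc_phase j). Qed.

(** Skew by construction from the entries below the diagonal, since rounding a skew matrix entry by
    entry need not keep it skew. *)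
Definition twist j k : int := if (k < j)%N then a j k else if (j < k)%N then - a k j else 0.

Lemma translationC j k : translation k *m translation j =
  expi2pi (frac (twist j k)) *: (translation j *m translation k).
Proof.
apply: monomial_mx_twist => [x|x /=]; last exact: shiftC.
rewrite !phase_shift /twist; case: ltngtP => jk.
- by rewrite mulr1; ring.
- rewrite mulr1 /frac mulrNz mulNr.
  rewrite -[LHS]mul1r -(expi2piN ((a k j)%:~R / p%:R)); ring.
- by rewrite (ord_inj jk) /frac mul0r expi2pi0 !mulr1 mul1r mulrC.
Qed.

Definition modulation (b : int) k : 'M[R[i]]_m :=
  monomial_mx cardI (fun x => expi2pi (frac b * (x k)%:R)) id.

Lemma modulation_unitary b k : modulation b k *m (modulation b k)^t* = 1%:M.
Proof. by apply: monomial_mx_unitary => // x; exact: normc_expi2pi. Qed.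

Lemma translation_modulation b j k : translation j *m modulation b k =
  (if j == k then expi2pi (frac b) else 1) *: (modulation b k *m translation j).
Proof.
apply: monomial_mx_twist => [x|x] //=; rewrite ffunE eq_sym.
by case: eqP => _; rewrite ?expi2pi_ordS; ring.
Qed.

End TwistedTranslations.

(** * Similarity in C*-algebras *)

Section CStarAlgebra.
Variables (R : realType) (A : cstarAlgType R).
Implicit Types (x y z e f : A).

Lemma cnorm0 : cnorm (0 : A) = 0.
Proof. by rewrite -(scale0r 0) cnormZ ComplexField.Normc.normc0 mul0r. Qed.

Lemma cnormN x : cnorm (- x) = cnorm x.
Proof. by rewrite -scaleN1r cnormZ normcN ComplexField.Normc.normc1 mul1r. Qed.

Lemma cnorm_ge0 x : 0 <= cnorm x.
Proof. by have := cnormD x (- x); rewrite subrr cnorm0 cnormN; lra. Qed.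

Lemma cnorm_sum_pow x r k : cnorm x <= r -> r < 1 ->
  cnorm (\sum_(i < k) x ^+ i) <= cnorm (1 : A) / (1 - r).
Proof.
move=> xr r1; have c0 := cnorm_ge0 1; have x0 := cnorm_ge0 x.
rewrite ler_pdivlMr ?subr_gt0 //.
elim: k => [|k IHk]; first by rewrite big_ord0 cnorm0 mul0r.
rewrite big_ord_recl expr0; under eq_bigr do rewrite exprS.
rewrite -mulr_sumr; set S := \sum_(i < k) _ in IHk *.
have S0 := cnorm_ge0 S.
have := cnormD 1 (x * S); have := cnormM x S; nra.
Qed.

Lemma cnormX_le x k : cnorm (x ^+ k) <= cnorm x ^+ k * cnorm (1 : A).
Proof.
elim: k => [|k IHk]; first by rewrite !expr0 mul1r.
rewrite !exprS -mulrA; apply: le_trans (cnormM _ _) _.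
by rewrite ler_wpM2l // cnorm_ge0.
Qed.

(** The partial sums [s k] of the geometric series in [t = 1 - x] are Cauchy, and
    [x * s k = 1 - t ^+ k] tends to 1. *)
Lemma neumann_series x : cnorm (1 - x) < 1 -> exists y, x * y = 1.
Proof.
move=> x1; set t := 1 - x in x1; have t0 : 0 <= cnorm t by exact: cnorm_ge0.
pose s k := \sum_(i < k) t ^+ i.
pose C := cnorm (1 : A) * (cnorm (1 : A) / (1 - cnorm t)).
have C0 : 0 <= C.
  by rewrite mulr_ge0 ?divr_ge0 ?cnorm_ge0 // subr_ge0 ltW.
have sD k j : s (k + j)%N = s k + t ^+ k * s j.
  rewrite /s big_split_ord /= mulr_sumr; congr (_ + _).
  by apply: eq_bigr => i _; rewrite exprD.
have tail m k : (k <= m)%N -> cnorm (s m - s k) <= cnorm t ^+ k * C.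
  move=> km; have -> : s m - s k = t ^+ k * s (m - k)%N.
    by rewrite -[in LHS](subnKC km) sD addrC addKr.
  apply: le_trans (cnormM _ _) _; rewrite mulrA.
  by apply: ler_pM; rewrite ?cnorm_ge0 ?cnormX_le ?cnorm_sum_pow.
have small (e : R) : 0 < e -> exists K, forall k, (K <= k)%N -> cnorm t ^+ k * C < e.
  move=> e0; have C1 : 0 < C + 1 by lra.
  have t1 : `|cnorm t| < 1 by rewrite ger0_norm.
  have /cvgrPdist_lt /(_ _ (divr_gt0 e0 C1)) [K _ HK] := cvg_expr t1.
  exists K => k /HK /=; rewrite sub0r normrN ger0_norm ?exprn_ge0 //.
  rewrite ltr_pdivlMr // => lt_e; apply: le_lt_trans lt_e.
  by rewrite ler_wpM2l ?exprn_ge0 // lerDl.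
have [|l sl] := @cnorm_complete R A s.
  move=> e e0; have [K HK] := small e e0; exists K => m k Km Kk.
  have [km|/ltnW mk] := leqP k m; first by apply: le_lt_trans (tail _ _ km) (HK _ Kk).
  by rewrite -opprB cnormN; apply: le_lt_trans (tail _ _ mk) (HK _ Km).
exists l; apply/eqP; rewrite -subr_eq0; apply/eqP/cnorm_eq0/le_anti.
rewrite cnorm_ge0 andbT; apply/ler_addgt0Pl => e e0; rewrite addr0.
have x0 := cnorm_ge0 x; have e2 : 0 < e / 2 by rewrite divr_gt0.
have [N1 H1] := sl (e / 2 / (cnorm x + 1)) ltac:(by rewrite divr_gt0 //; lra).
have [N2 H2] := small _ e2.
pose N := maxn N1 N2; have {}H1 := H1 N (leq_maxl _ _).
have {}H2 := H2 N (leq_maxr _ _).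
have xs : x * s N = 1 - t ^+ N.
  by rewrite -[RHS]opprB subrX1 /t [1 - x - 1]addrC addKr mulNr opprK.
have -> : x * l - 1 = - (x * (s N - l)) - t ^+ N.
  by rewrite mulrBr xs !opprB addrA addrAC addrK.
have xH : cnorm x * cnorm (s N - l) <= e / 2.
  apply: le_trans (mulr_divS_le x0 e2).
  by rewrite ler_wpM2l // ltW.
have := cnormD (- (x * (s N - l))) (- t ^+ N); rewrite !cnormN.
have := cnormM x (s N - l); have := tail _ _ (leqnSn N).
rewrite {1}/s big_ord_recr /= addrAC subrr add0r.
move: (cnorm t ^+ N * C) H2 => r; lra.
Qed.

Lemma projection_norm e : projection e -> cnorm e <= 1.
Proof.
move=> [es ee]; have := cnorm_star e; rewrite es ee; have := cnorm_ge0 e; nra.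
Qed.

(** The element [z = e f + (1 - e) (1 - f)] satisfies [e z = e f = z f]. Its distance to 1 is at
    most twice that of [e] and [f], so the Neumann series gives a right inverse. *)
Lemma close_projections_similar e f : projection e -> projection f ->
  cnorm (e - f) < 4^-1 -> exists z y, z * y = 1 /\ e * z = z * f.
Proof.
move=> eP fP ef; have [[_ ee] [_ ff]] := (eP, fP).
pose z := e * f + (1 - e) * (1 - f).
have zE : z = 1 - (e * (e - f) - (e - f) * f).
  rewrite /z mulrBl mul1r !mulrBr mulr1 mulrBl ee ff.
  by move: (e * f) => c; rewrite !opprB !addrA (addrC c).
have [y zy] : exists y, z * y = 1.
  apply: neumann_series; rewrite zE opprB addrC subrK.
  have := cnormD (e * (e - f)) (- ((e - f) * f)); rewrite cnormN.
  have := cnormM e (e - f); have := cnormM (e - f) f.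
  have := projection_norm eP; have := projection_norm fP.
  have := cnorm_ge0 (e - f); have := cnorm_ge0 e; have := cnorm_ge0 f.
  nra.
exists z, y; split=> //.
have -> : e * z = e * f.
  by rewrite /z mulrDr !mulrA ee [e * (1 - e)]mulrBr mulr1 ee subrr mul0r addr0.
by rewrite /z mulrDl -!mulrA ff [(1 - f) * f]mulrBl mul1r ff subrr mulr0 addr0.
Qed.

End CStarAlgebra.

(** * Conjugation by a unitary *)

Section InnerAutomorphism.
Variables (R : realType) (B : cstarAlgType R) (w : B) (w_unitary : unitary w).

(** The proof of unitarity is an argument so that the multiplicative structure can be attached to
    the function itself. *)
Definition adstar of unitary w := fun b : B => star w * b * w.
Local Notation ad := (adstar w_unitary).

Fact adstar_is_linear : linear ad.
Proof.
by move=> c x y; rewrite /adstar mulrDr mulrDl -scalerAr -scalerAl.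
Qed.

Fact adstar_is_monoid_morphism : monoid_morphism ad.
Proof.
have [w1 w2] := w_unitary; split=> [|x y]; rewrite /adstar ?mulr1 //.
by rewrite !mulrA -[_ * w * star w]mulrA w2 mulr1.
Qed.

HB.instance Definition _ := GRing.isLinear.Build R[i] B B *:%R ad adstar_is_linear.
HB.instance Definition _ := GRing.isMonoidMorphism.Build B B ad adstar_is_monoid_morphism.

Lemma adstar_star_preserving : star_preserving ad.
Proof. by move=> x; rewrite /adstar !starM starK mulrA. Qed.

End InnerAutomorphism.

Lemma torus_relations_morphism (R : realType) d (theta : 'M[R]_d)
    (A B : cstarAlgType R) (u : 'I_d -> A) (f : {lrmorphism A -> B}) :
  star_preserving f -> torus_relations theta u -> torus_relations theta (f \o u).
Proof.
move=> fs [uu ur]; split=> [j|j k] /=.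
  by have [u1 u2] := uu j; split; rewrite -fs -rmorphM ?u1 ?u2 rmorph1.
by rewrite -!(rmorphM f) ur; exact: linearZ.
Qed.

(** If [z] intertwines [alpha (e j)] with [e (ordS j)], then [w * phi z] intertwines their images
    under [phi] without [alpha], because [phi (alpha (e j))] is [phi (e j)] conjugated by [w]. *)
Lemma rokhlin_intertwined (R : realType) (A B : cstarAlgType R)
    (phi : {lrmorphism A -> B}) (alpha : {lrmorphism A -> A}) (w : B) n :
  star_preserving phi -> star_preserving alpha -> unitary w ->
  (forall x, phi (alpha x) = star w * phi x * w) ->
  rokhlin_property n alpha ->
  exists f : 'I_n -> B, [/\ forall j, projection (f j),
    forall i j, i != j -> f i * f j = 0, \sum_j f j = 1 &
    forall j, exists g h, g * h = 1 /\ f j * g = g * f (ordS j)].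
Proof.
move=> phis alphas [w1 w2] phi_alpha rok.
(* The tolerance 1/4 is the one accepted by [close_projections_similar]. *)
have [|e [eP e0 e1 ae _]] := rok [::] 4^-1; first by lra.
have morph_proj (C : cstarAlgType R) (f : {lrmorphism A -> C}) x :
    star_preserving f -> projection x -> projection (f x).
  by move=> fs [xs xx]; split; rewrite -?fs ?xs -?rmorphM ?xx.
exists (phi \o e); split=> [j|i j ij||j] /=.
- exact: morph_proj.
- by rewrite -rmorphM e0 // rmorph0.
- by rewrite -rmorph_sum e1 rmorph1.
have [z [y [zy ez]]] := close_projections_similar
  (morph_proj _ _ _ alphas (eP j)) (eP (ordS j)) (ae j).
exists (w * phi z), (phi y * star w); split.
  by rewrite mulrA -(mulrA w) -rmorphM zy rmorph1 mulr1.
have : phi (alpha (e j)) * phi z = phi z * phi (e (ordS j)).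
  by rewrite -!(rmorphM phi) ez.
rewrite phi_alpha => ez'.
by rewrite -[RHS]mulrA -ez' !mulrA w2 mul1r.
Qed.

(** * Unitary classes and limits of their commutation phases *)

Section AsymptoticUnitaries.
Variables (R : realType) (q : nat -> nat).
Implicit Types (x y : bseq R q).

Fact unitary_bseq_subproof (z : matseq R q) :
  (forall N, z N *m (z N)^t* = 1%:M) -> exists r, 0 <= r /\ evbound z r.
Proof.
by move=> zz; exists 1; split=> //; exists 0%N => N _; exact: opbound_unitary.
Qed.
Definition unitary_bseq (z : matseq R q) (zz : forall N, z N *m (z N)^t* = 1%:M) :=
  BSeq (unitary_bseq_subproof zz).

Lemma cls_unitary x : (forall N, x N *m (x N)^t* = 1%:M) -> unitary (cls x).
Proof.
move=> xx; rewrite /unitary; have -> : star (cls x) = cls (badj x) by exact: asstarE.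
by split; rewrite asymp_mulE; apply: eq_cls => N //=; exact: mulmx1C.
Qed.

(** The defect is [(l N - l0) *: (y N *m x N)], a null scalar times a bounded sequence: the quotient
    sees only the limit phase. *)
Lemma cls_twist x y (l : nat -> R[i]) (l0 : R[i]) :
  (forall N, x N *m y N = l N *: (y N *m x N)) ->
  (forall r : R, 0 < r -> exists N0, forall N, (N0 <= N)%N -> normc (l N - l0) < r) ->
  cls x * cls y = l0 *: (cls y * cls x).
Proof.
move=> xy l_l0; rewrite !asymp_mulE asymp_scaleE; apply/clsP => r r0.
have [s [s0 [N1 yxs]]] := bvalP (bmul y x).
have [N2 HN2] := l_l0 (r / (s + 1)) ltac:(by rewrite divr_gt0 //; lra).
exists (maxn N1 N2) => N; rewrite geq_max => /andP[n1 n2].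
rewrite /= xy -scalerBl; apply: opboundW (opboundZ (l N - l0) (yxs N n1)).
apply: le_trans (mulr_divS_le s0 r0).
by rewrite mulrC ler_wpM2l // ltW // HN2.
Qed.

End AsymptoticUnitaries.

Lemma frac_floor_dist (R : realType) (p : nat) (t : R) : (0 < p)%N ->
  `|frac R p (Num.floor (p%:R * t)) - t| <= p%:R^-1.
Proof.
move=> p0; have pR : 0 < p%:R :> R by rewrite ltr0n.
have /andP[le_f lt_f] := floor_itv (p%:R * t).
rewrite intrD in lt_f; rewrite /frac ler_norml; apply/andP; split.
  rewrite lerBrDr ler_pdivlMr // mulrDl mulNr mulVf ?gt_eqF // mulrC; lra.
by rewrite lerBlDr ler_pdivrMr // mulrDl mulVf ?gt_eqF // (mulrC t); lra.
Qed.

Lemma expi2pi_approx (R : realType) (p : nat -> nat) (b : nat -> int) (t r : R) :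
  (forall N, (N < p N)%N) ->
  (forall N, `|frac R (p N) (b N) - t| <= (p N)%:R^-1) -> 0 < r ->
  exists N0, forall N, (N0 <= N)%N ->
    normc (expi2pi (frac R (p N) (b N)) - expi2pi t) < r.
Proof.
move=> p_gt bt r0; have [s s0 Hs] := expi2pi_continuous t r0.
exists (Num.bound s^-1) => N leN; apply: Hs; apply: le_lt_trans (bt N) _.
rewrite invf_plt ?posrE //; last by rewrite ltr0n (leq_ltn_trans _ (p_gt N)).
apply: lt_le_trans (archi_boundP _) _; first by rewrite invr_ge0 ltW.
by rewrite ler_nat (leq_trans leN) // ltnW.
Qed.

(** Above the diagonal [twist] negates the rounded transposed entry, and skewness of [theta] carries
    the estimate over; on the diagonal both sides vanish. *)
Lemma frac_twist_dist (R : realType) d (theta : 'M[R]_d) (p : nat) (j k : 'I_d) :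
  skew_symmetric_mx theta -> (0 < p)%N ->
  `|frac R p (twist (fun j k => Num.floor (p%:R * theta j k)) j k) - theta j k|
    <= p%:R^-1.
Proof.
move=> skew p0.
have skewE i l : theta i l = - theta l i.
  by have /matrixP/(_ l i) := skew; rewrite !mxE.
rewrite /twist; case: ltngtP => jk.
- exact: frac_floor_dist.
- rewrite (skewE j k) /frac mulrNz mulNr -opprD normrN; exact: frac_floor_dist.
- have {jk}-> : j = k by apply/esym/ord_inj.
  have -> : theta k k = 0 by have := skewE k k; lra.
  by rewrite /frac mul0r subr0 normr0 invr_ge0 ler0n.
Qed.

Theorem corollary3p15 (R : realType) (d : nat) (theta : 'M[R]_d)
    (A : cstarAlgType R) (u : 'I_d -> A) (n : nat) (k : 'I_d)
    (alpha : {lrmorphism A -> A}) :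
  skew_symmetric_mx theta ->
  nondegenerate_mx theta ->
  noncommutative_torus theta u ->
  (1 <= n)%N -> n <> 1%N ->
  star_automorphism alpha ->
  alpha (u k) = expi2pi (n%:R^-1 : R) *: u k ->
  (forall r : 'I_d, r != k -> alpha (u r) = u r) ->
  ~ rokhlin_property n alpha.
Proof.
move=> skew _ [u_rel univ] n_gt0 n_neq1 [alpha_star _] alpha_k alpha_r rok.
(* Exceeding [N] makes the phases converge; exceeding [n] excludes that [n] is a positive power of
   [p N]. *)
pose p N := sval (prime_above (maxn N n)).
have p_prime N : prime (p N) by rewrite /p; case: prime_above.
have p_gt N : (maxn N n < p N)%N by rewrite /p; case: prime_above.
have p_gtN N : (N < p N)%N by apply: leq_ltn_trans (p_gt N); exact: leq_maxl.
have p_gtn N : (n < p N)%N by apply: leq_ltn_trans (p_gt N); exact: leq_maxr.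
have p0 N : (0 < p N)%N by exact: prime_gt0.
pose q N := (p N ^ d).-1.
have q1 N : (q N).+1 = (p N ^ d)%N by rewrite prednK // expn_gt0 p0.
have cardI N : #|{ffun 'I_d -> 'I_(p N)}| = (q N).+1.
  by rewrite card_ffun !card_ord q1.
pose a N (j l : 'I_d) : int := Num.floor ((p N)%:R * theta j l).
pose b N : int := Num.floor ((p N)%:R * n%:R^-1 : R).
pose U j := unitary_bseq
  (z := fun N => translation R (a N) (cardI N) j)
  (fun N => translation_unitary R (a N) (cardI N) j).
pose W := unitary_bseq
  (z := fun N => modulation R (cardI N) (b N) k)
  (fun N => modulation_unitary R (cardI N) (b N) k).
have W_unitary : unitary (cls W).
  by apply: cls_unitary => N; exact: modulation_unitary.
have U_rel : torus_relations theta (fun j => cls (U j)).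
  split=> [j|j l]; first by apply: cls_unitary => N; exact: translation_unitary.
  apply: (cls_twist (l := fun N => expi2pi (frac R (p N) (twist (a N) j l)))).
    by move=> N; exact: translationC.
  by move=> r; apply: expi2pi_approx => // N; exact: frac_twist_dist.
have UW j : cls (U j) * cls W =
    (if j == k then expi2pi n%:R^-1 else 1) *: (cls W * cls (U j)).
  apply: (cls_twist (l := fun N => if j == k then expi2pi (frac R (p N) (b N)) else 1)).
    by move=> N; exact: translation_modulation.
  move=> r r0; case: ifP => _; last first.
    by exists 0%N => N _; rewrite subrr ComplexField.Normc.normc0.
  by apply: expi2pi_approx => // N; exact: frac_floor_dist.
have [phi [phi_star phi_u _]] := univ _ _ U_rel.
have phi_alpha x : phi (alpha x) = star (cls W) * phi x * cls W.
  pose ad_phi : {lrmorphism A -> asymp R q} := adstar W_unitary \o phi.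
  pose phi_al : {lrmorphism A -> asymp R q} := phi \o alpha.
  have ad_star : star_preserving ad_phi.
    by move=> y; rewrite /= phi_star; exact: adstar_star_preserving.
  (* [ad_phi] and [phi_al] agree on the generators, so both coincide with the morphism [psi]
     determined by these values. *)
  have [psi [_ _ psi_uniq]] := univ _ _ (torus_relations_morphism ad_star u_rel).
  have -> : star (cls W) * phi x * cls W = psi x by exact: (psi_uniq ad_phi).
  apply: (psi_uniq phi_al) => [y|j] /=; first by rewrite alpha_star phi_star.
  have [W1 _] := W_unitary.
  (* Commuting [cls W] past [cls (U j)] produces exactly the scalar by which [alpha] multiplies
     [u j]. *)
  rewrite /adstar phi_u -mulrA UW -scalerAr mulrA W1 mul1r.
  case: eqVneq => [->|jk].
    by rewrite alpha_k -(phi_u k); exact: linearZ.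
  by rewrite alpha_r // phi_u scale1r.
have [f [fP f0 f1 fg]] :=
  rokhlin_intertwined phi_star alpha_star W_unitary phi_alpha rok.
have [N /(_ N (leqnn N))] := intertwined_partition_dvd fP f0 f1 fg.
(* A divisor of a prime power is a power of that prime: exponent 0 gives [n = 1], a positive one
   gives [n >= p N]. *)
rewrite q1 => /(dvdn_pfactor _ _ (p_prime N))[[|m] _ nE].
  by apply: n_neq1; rewrite nE expn0.
have := p_gtn N; rewrite nE expnS ltnNge leq_pmulr // expn_gt0 p0 //.
Qed.
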